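(* Let $\phi\colon\mathbb{D}\to\mathbb{D}$ be an analytic self-map. There exists $w\in H^2$, $w\not\equiv0$, such that the weighted composition operator $M_wC_\phi\colon f\mapsto w\,(f\circ\phi)$ is a (bounded) Hilbert–Schmidt operator on $H^2$ if and only if $$\int_{\mathbb{T}}\log\Big(\frac{1}{1-|\phi^\ast|}\Big)\,dm<+\infty .$$
   Context: $\mathbb{D}$ is the open unit disk, $\mathbb{T}=\partial\mathbb{D}$, $m$ the normalized Lebesgue measure on $\mathbb{T}$, $H^2$ the Hardy space. $\phi^\ast(\xi)=\lim_{r\to1^-}\phi(r\xi)$ is the radial limit function of $\phi$, defined $m$-a.e.; the integrand is taken to be $+\infty$ where $|\phi^\ast|=1$. *)

(* Defs.v *)
From HB Require Import structures.
From mathcomp Require Import all_boot all_order all_algebra.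
From mathcomp Require Import all_classical all_reals all_analysis.
From mathcomp Require Export complex.
Import Order.TTheory GRing.Theory Num.Theory numFieldNormedType.Exports.
Set Implicit Arguments. Unset Strict Implicit. Unset Printing Implicit Defensive.
Local Open Scope ring_scope.
Local Open Scope classical_set_scope.

Section Hardy.
Variable R : realType.
Local Notation C := R[i].

Definition cmod (z : C) : R := ComplexField.Normc.normc z.

Definition expi (t : R) : C := ((cos t) +i* (sin t))%C.

Definition disk_series (f : C -> C) (c : nat -> C) : Prop :=
  forall z : C, cmod z < 1 ->
    cmod (\sum_(0 <= n < N) c n * z ^+ n - f z) @[N --> \oo] --> (0 : R).

(* f is analytic on D (holomorphic on the disk = Taylor series at 0
   converging on all of D) *)
Definition analytic_on_disk (f : C -> C) : Prop := exists c, disk_series f c.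

Definition analytic_selfmap (phi : C -> C) : Prop :=
  analytic_on_disk phi /\ (forall z, cmod z < 1 -> cmod (phi z) < 1).

Definition H2norm2 (c : nat -> C) : \bar R :=
  (\sum_(0 <= n <oo) ((cmod (c n)) ^+ 2)%:E)%E.

Definition inH2 (f : C -> C) : Prop :=
  exists c, disk_series f c /\ (H2norm2 c < +oo)%E.

Definition wcomp (w phi : C -> C) (f : C -> C) : C -> C :=
  fun z => w z * f (phi z).

Definition wcomp_bounded (w phi : C -> C) : Prop :=
  exists K : R, forall f c, disk_series f c -> (H2norm2 c < +oo)%E ->
    exists b, disk_series (wcomp w phi f) b /\
      (H2norm2 b <= K%:E * H2norm2 c)%E.

(* Hilbert--Schmidt: bounded and sum_n ||M_w C_phi e_n||^2 < oo for the
   orthonormal basis e_n = z^n of H^2; b n are the Taylor coefficients of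
   M_w C_phi e_n = w * phi^n *)
Definition wcomp_HS (w phi : C -> C) : Prop :=
  wcomp_bounded w phi /\
  exists b : nat -> nat -> C,
    (forall n, disk_series (wcomp w phi (fun z => z ^+ n)) (b n)) /\
    (\sum_(0 <= n <oo) H2norm2 (b n) < +oo)%E.

Definition radial_limit (phi : C -> C) (t : R) (L : C) : Prop :=
  cmod (phi ((r%:C)%C * expi t) - L) @[r --> (1 : R)^'-] --> (0 : R).

(* the radial limit function (defined a.e.; an arbitrary value where the
   limit does not exist -- a null set by Fatou's theorem) *)
Definition phistar (phi : C -> C) (t : R) : C :=
  xget 0 [set L | radial_limit phi t L].

Definition log_integrand (phi : C -> C) (t : R) : \bar R :=
  if cmod (phistar phi t) < 1 then (ln ((1 - cmod (phistar phi t))^-1))%:E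
  else +oo%E.

Definition circle_integral (g : R -> \bar R) : \bar R :=
  (((2 * pi)^-1)%:E * \int[@lebesgue_measure R]_(t in `[0%R, (2 * pi)%R]) g t)%E.

End Hardy.

(* Main.v *)
Require Import Defs.
From mathcomp Require Import all_boot all_order all_algebra.
From mathcomp Require Import all_classical all_reals all_analysis.
From mathcomp Require Import measurable_realfun complex ring lra.
Import Order.TTheory GRing.Theory Num.Theory numFieldNormedType.Exports.
Set Implicit Arguments. Unset Strict Implicit. Unset Printing Implicit Defensive.
Local Open Scope ring_scope.
Local Open Scope classical_set_scope.

Local Notation Re := complex.Re.
Local Notation Im := complex.Im.
#[local] Arguments cmod : simpl never.

(** Summing the geometric series, [sum_n ||w phi^n||^2] is the supremum over [r < 1] of the
    circle means of [|w|^2 / (1 - |phi|^2)] at radius [r].  Everything then rests on outer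
    functions: for integrable [u], the exponential [W] of (half) the Herglotz integral of [u]
    is analytic and nonvanishing with [|W|^2 = exp P[u]], [P[u]] the Poisson integral.

    If [w] gives a Hilbert-Schmidt operator and [a_j] is its first nonzero coefficient, take
    for [u] a truncation of [-ln (1 - |phi|)] at radius [r]; Bessel's inequality for the
    [j]-th coefficient of [w(r z) W(z)] bounds [|a_j r^j|^2 exp (mean u)] by the mean of
    [|w|^2 e^u], hence by twice the Hilbert-Schmidt norm squared.  This bounds the mean of
    [-ln (1 - |phi|)] uniformly in [r], and Fatou's lemma passes to the radial limit.

    Conversely, Fatou's theorem provides the boundary function [phi^*], and [W] is built from
    [u = ln (1 - |phi^*|)].  Jensen's inequality for the Poisson kernel yields
    [|W|^2 <= 1 - |phi|] on the whole disk, so [sum_n |W phi^n|^2 <= 1] pointwise and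
    Bessel's inequality bounds the Hilbert-Schmidt norm by 1. *)

(** Analyticity means a Taylor series on the whole disk, so no contour integral occurs: products,
    exponentials and compositions are handled on absolutely summable coefficients, and circle means
    through the orthogonality of the [expi t ^+ n]. The weight [w] may vanish at 0, so its value
    there could give nothing; its first nonzero coefficient replaces it, at the price of a factor
    r^j that stays bounded below because the radii used are at least 1/2. The factor 2 comes from 1
    - |phi|^2 = (1 - |phi|)(1 + |phi|). In the converse, |W|^2 <= 1 - |phi| makes the geometric sum
    at most 1 / (1 + |phi|). The integrand is built from [phistar], a pointwise choice, and its
    measurability is not established. It is only compared pointwise with measurable functions,
    through monotonicity of the integral of nonnegative functions: from above with a lower limit of
    radial functions, from below with a function built from an almost everywhere boundary
    function. *)

Section ComplexModulus.
Variable R : realType.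
Local Notation C := R[i].
Implicit Types z w : C.

Lemma cmod_sqr z : cmod z ^+ 2 = Re z ^+ 2 + Im z ^+ 2.
Proof. by case: z => a b; rewrite /cmod /= sqr_sqrtr // addr_ge0 ?sqr_ge0. Qed.

Lemma cmod_ge0 z : 0 <= cmod z.
Proof. by case: z => a b; exact: sqrtr_ge0. Qed.

Lemma cmod0 : cmod (0 : C) = 0. Proof. exact: ComplexField.Normc.normc0. Qed.

Lemma cmod1 : cmod (1 : C) = 1. Proof. exact: ComplexField.Normc.normc1. Qed.

Lemma cmodM z w : cmod (z * w) = cmod z * cmod w.
Proof. exact: ComplexField.Normc.normcM. Qed.

Lemma cmodV z : cmod z^-1 = (cmod z)^-1.
Proof. exact: ComplexField.Normc.normcV. Qed.

Lemma cmodN z : cmod (- z) = cmod z.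
Proof. by case: z => a b; rewrite /cmod /= !sqrrN. Qed.

Lemma cmod_le_add z w : cmod (z + w) <= cmod z + cmod w.
Proof. exact: le_normcD. Qed.

Lemma cmod_le_sub z w : cmod (z - w) <= cmod z + cmod w.
Proof. by rewrite -(cmodN w) cmod_le_add. Qed.

Lemma cmodB z w : cmod (z - w) = cmod (w - z).
Proof. by rewrite -cmodN opprB. Qed.

Lemma cmod_eq0 z : (cmod z == 0) = (z == 0).
Proof.
apply/eqP/eqP => [|->]; last exact: cmod0.
exact: ComplexField.Normc.eq0_normc.
Qed.

Lemma cmodX z n : cmod (z ^+ n) = cmod z ^+ n.
Proof. by elim: n => [|n IH]; rewrite ?expr0 ?cmod1// !exprS cmodM IH. Qed.

Lemma cmod_real (x : R) : cmod (x%:C)%C = `|x|.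
Proof. by rewrite /cmod /= expr0n /= addr0 sqrtr_sqr. Qed.

Lemma cmod_le_sum (I : Type) (r : seq I) (P : pred I) (F : I -> C) :
  cmod (\sum_(i <- r | P i) F i) <= \sum_(i <- r | P i) cmod (F i).
Proof.
elim/big_rec2: _ => [|i x y _ h]; first by rewrite cmod0.
exact: le_trans (cmod_le_add _ _) (lerD (lexx _) h).
Qed.

Lemma Re_add z w : Re (z + w) = Re z + Re w. Proof. by case: z w => ? ? []. Qed.
Lemma Im_add z w : Im (z + w) = Im z + Im w. Proof. by case: z w => ? ? []. Qed.
Lemma Re_opp z : Re (- z) = - Re z. Proof. by case: z. Qed.
Lemma Im_opp z : Im (- z) = - Im z. Proof. by case: z. Qed.
Lemma Re_mul z w : Re (z * w) = Re z * Re w - Im z * Im w.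
Proof. by case: z w => ? ? []. Qed.
Lemma Im_mul z w : Im (z * w) = Re z * Im w + Im z * Re w.
Proof. by case: z w => ? ? []. Qed.

Lemma Re_sum (I : Type) (r : seq I) (P : pred I) (F : I -> C) :
  Re (\sum_(i <- r | P i) F i) = \sum_(i <- r | P i) Re (F i).
Proof. by apply: (big_morph (@complex.Re R)) => // ? ?; rewrite Re_add. Qed.

Lemma Im_sum (I : Type) (r : seq I) (P : pred I) (F : I -> C) :
  Im (\sum_(i <- r | P i) F i) = \sum_(i <- r | P i) Im (F i).
Proof. by apply: (big_morph (@complex.Im R)) => // ? ?; rewrite Im_add. Qed.

Lemma Re_le_cmod z : `|Re z| <= cmod z.
Proof.
rewrite -(@ler_sqr _ _ (cmod z)) ?nnegrE ?cmod_ge0// cmod_sqr real_normK ?num_real//.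
by rewrite lerDl sqr_ge0.
Qed.

Lemma Im_le_cmod z : `|Im z| <= cmod z.
Proof.
rewrite -(@ler_sqr _ _ (cmod z)) ?nnegrE ?cmod_ge0// cmod_sqr real_normK ?num_real//.
by rewrite lerDr sqr_ge0.
Qed.

Lemma cmod_le_ReIm z : cmod z <= `|Re z| + `|Im z|.
Proof.
rewrite -(@ler_sqr _ (cmod z)) ?nnegrE ?cmod_ge0 ?addr_ge0// cmod_sqr sqrrD.
rewrite !real_normK ?num_real// -addrA [_ *+ 2 + _]addrC addrA lerDl.
by rewrite mulrn_wge0// mulr_ge0.
Qed.

Lemma cmod_conj z : cmod (z^*)%C = cmod z.
Proof. by case: z => a b; rewrite /cmod /= sqrrN. Qed.

Lemma mulc_conj z : z * (z^*)%C = ((cmod z ^+ 2)%:C)%C.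
Proof.
rewrite cmod_sqr; case: z => a b /=; apply/eqP; rewrite eq_complex /=.
by apply/andP; split; apply/eqP; ring.
Qed.

Lemma cmod_ltP z : cmod z < 1 -> 1 - cmod z ^+ 2 > 0.
Proof. by move=> h; rewrite subr_gt0 expr_lt1// cmod_ge0. Qed.

Lemma cmod_dist z w : `|cmod z - cmod w| <= cmod (z - w).
Proof.
rewrite ler_norml lerNl opprB !lerBlDr; apply/andP; split.
  by rewrite cmodB; have := cmod_le_add (w - z) z; rewrite subrK.
by have := cmod_le_add (z - w) w; rewrite subrK.
Qed.

(** Complex limits are written as real limits of a modulus, the form used by [disk_series] and
    [radial_limit]; passing to coordinates gives access to the algebra of real limits. *)
Lemma ccvgP (T : Type) (F : set_system T) {FF : ProperFilter F} (u : T -> C) (l : C) :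
  (cmod (u x - l) @[x --> F] --> (0 : R)) <->
  (Re (u x) @[x --> F] --> Re l) /\ (Im (u x) @[x --> F] --> Im l).
Proof.
split=> [h|[hr hi]].
  move/cvgrPdist_lt : h => h; split; apply/cvgrPdist_lt => e e0;
    (apply: filterS (h e e0) => x; rewrite sub0r normrN ger0_norm ?cmod_ge0// => hx).
  - apply: le_lt_trans hx; have := Re_le_cmod (l - u x).
    by rewrite Re_add Re_opp cmodB.
  - apply: le_lt_trans hx; have := Im_le_cmod (l - u x).
    by rewrite Im_add Im_opp cmodB.
have h : (`|Re (u x) - Re l| + `|Im (u x) - Im l|) @[x --> F] --> (0 + 0 : R).
  apply: cvgD; [rewrite -(normr0 R) -(subrr (Re l))|rewrite -(normr0 R) -(subrr (Im l))];
    by apply: cvg_norm; apply: cvgB => //; exact: cvg_cst.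
rewrite addr0 in h.
apply: (squeeze_cvgr _ (cvg_cst _) h).
by near=> x; rewrite cmod_ge0 /= (le_trans (cmod_le_ReIm _))// !Re_add !Im_add !Re_opp !Im_opp.
Unshelve. all: by end_near. Qed.

Lemma cvg_cmod (T : Type) (F : set_system T) {FF : ProperFilter F} (u : T -> C) (l : C) :
  (cmod (u x - l) @[x --> F] --> (0 : R)) -> cmod (u x) @[x --> F] --> cmod l.
Proof.
move/cvgrPdist_lt => h; apply/cvgrPdist_lt => e e0.
apply: filterS (h e e0) => x; rewrite sub0r normrN ger0_norm ?cmod_ge0//.
by rewrite cmodB; apply: le_lt_trans; exact: cmod_dist.
Qed.

Lemma ccvgD (T : Type) (F : set_system T) {FF : ProperFilter F} (u v : T -> C) (l m : C) :
  (cmod (u x - l) @[x --> F] --> (0 : R)) -> (cmod (v x - m) @[x --> F] --> (0 : R)) ->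
  (cmod (u x + v x - (l + m)) @[x --> F] --> (0 : R)).
Proof.
move=> /ccvgP [a b] /ccvgP [c d]; apply/ccvgP.
under eq_fun do rewrite Re_add; under [X in _ /\ (X @ _ --> _)]eq_fun do rewrite Im_add.
by rewrite Re_add Im_add; split; apply: cvgD.
Qed.

Lemma ccvgM (T : Type) (F : set_system T) {FF : ProperFilter F} (u v : T -> C) (l m : C) :
  (cmod (u x - l) @[x --> F] --> (0 : R)) -> (cmod (v x - m) @[x --> F] --> (0 : R)) ->
  (cmod (u x * v x - (l * m)) @[x --> F] --> (0 : R)).
Proof.
move=> /ccvgP [a b] /ccvgP [c d]; apply/ccvgP.
under eq_fun do rewrite Re_mul; under [X in _ /\ (X @ _ --> _)]eq_fun do rewrite Im_mul.
by rewrite Re_mul Im_mul; split; [apply: cvgB|apply: cvgD]; apply: cvgM.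
Qed.

Lemma ccvg_cst (T : Type) (F : set_system T) {FF : ProperFilter F} (l : C) :
  (cmod (l - l) @[x --> F] --> (0 : R)).
Proof. by rewrite subrr cmod0; exact: cvg_cst. Qed.

Lemma ccvg_sum (T : Type) (F : set_system T) {FF : ProperFilter F}
    (u : nat -> T -> C) (l : nat -> C) m :
  (forall i, cmod (u i x - l i) @[x --> F] --> (0 : R)) ->
  cmod (\sum_(0 <= i < m) u i x - \sum_(0 <= i < m) l i) @[x --> F] --> (0 : R).
Proof.
move=> hu; elim: m => [|m IH].
  by under eq_fun do rewrite !big_geq//; exact: ccvg_cst.
by under eq_fun do rewrite !big_nat_recr//=; exact: ccvgD.
Qed.

Lemma ccvgX (T : Type) (F : set_system T) {FF : ProperFilter F} (u : T -> C) (l : C) n :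
  (cmod (u x - l) @[x --> F] --> (0 : R)) ->
  (cmod (u x ^+ n - l ^+ n) @[x --> F] --> (0 : R)).
Proof.
move=> h; elim: n => [|n IH]; first by under eq_fun do rewrite !expr0; exact: ccvg_cst.
by under eq_fun do rewrite !exprS; exact: ccvgM.
Qed.

Lemma ccvg_unique (T : Type) (F : set_system T) {FF : ProperFilter F} (u : T -> C) (l m : C) :
  (cmod (u x - l) @[x --> F] --> (0 : R)) -> (cmod (u x - m) @[x --> F] --> (0 : R)) ->
  l = m.
Proof.
move=> /ccvgP [a b] /ccvgP [c d]; apply/eqP; rewrite eq_complex.
by rewrite (cvg_unique _ a c)// (cvg_unique _ b d)// !eqxx.
Qed.

End ComplexModulus.

(** * Absolute convergence, Cauchy products and interchange of summations for power series on the
    disk *)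

Section PowerSeries.
Variable R : realType.
Local Notation C := R[i].
Implicit Types (c a b : nat -> C) (f g : C -> C) (z : C).

Lemma sum_geometric_le (q : R) N :
  0 <= q -> q < 1 -> \sum_(0 <= n < N) q ^+ n <= (1 - q)^-1.
Proof.
move=> q0 q1; have d : 0 < 1 - q by rewrite subr_gt0.
have E : (\sum_(0 <= n < N) q ^+ n) * (1 - q) = 1 - q ^+ N.
  elim: N => [|N IH]; first by rewrite big_geq// mul0r expr0 subrr.
  by rewrite big_nat_recr//= mulrDl IH exprS; ring.
by rewrite -(@ler_pM2r _ (1 - q))// E mulVf ?gt_eqF// gerBl exprn_ge0.
Qed.

Lemma bounded_sum_is_cvgn (v : nat -> R) M :
  (forall N, \sum_(0 <= n < N) `|v n| <= M) ->
  cvgn (fun N => \sum_(0 <= n < N) v n).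
Proof.
move=> h; apply: (@normed_cvg _ R^o v).
have : cvgn (fun N => \sum_(0 <= n < N) `|v n|); last by [].
apply: nondecreasing_is_cvgn.
  by apply/nondecreasing_seqP => n; rewrite big_nat_recr//= lerDl.
by exists M => _ [n _ <-]; exact: h.
Qed.

Lemma bounded_sum_ccvg (u : nat -> C) M :
  (forall N, \sum_(0 <= n < N) cmod (u n) <= M) ->
  exists l, cmod (\sum_(0 <= n < N) u n - l) @[N --> \oo] --> (0 : R).
Proof.
move=> h.
have /bounded_sum_is_cvgn cr N : \sum_(0 <= n < N) `|Re (u n)| <= M.
  by apply: le_trans (h N); apply: ler_sum => n _; exact: Re_le_cmod.
have /bounded_sum_is_cvgn ci N : \sum_(0 <= n < N) `|Im (u n)| <= M.
  by apply: le_trans (h N); apply: ler_sum => n _; exact: Im_le_cmod.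
exists (limn (fun N => \sum_(0 <= n < N) Re (u n)) +i*
        limn (fun N => \sum_(0 <= n < N) Im (u n)))%C.
apply/ccvgP => /=.
by under eq_fun do rewrite Re_sum; under [X in _ /\ (X @ _ --> _)]eq_fun do rewrite Im_sum.
Qed.

(** A bound on partial sums, rather than convergence, is what products, powers and double sums hand
    on. *)
Definition abs_summable c := forall s : R, 0 <= s -> s < 1 ->
  exists M : R, forall N, \sum_(0 <= n < N) cmod (c n) * s ^+ n <= M.

(** Abel's argument: convergence at a real point q strictly between s and 1 bounds the terms c_n
    q^n, each being the difference of two consecutive errors, and the ratio s/q supplies a geometric
    series. *)
Lemma disk_series_abs_summable f c : disk_series f c -> abs_summable c.
Proof.
move=> hf s s0 s1; pose q := (1 + s) / 2.
have q1 : q < 1 by rewrite /q; lra.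
have q0 : 0 < q by rewrite /q; lra.
have sq : s < q by rewrite /q; lra.
have qq : cmod (q%:C)%C < 1 by rewrite cmod_real gtr0_norm.
have /(_ _ qq) h := hf.
have [B hB] : exists B : R, forall N,
    cmod (\sum_(0 <= n < N) c n * (q%:C)%C ^+ n - f (q%:C)%C) <= B.
  have /cvg_seq_bounded [B [_ hB]] : cvgn (fun N =>
    cmod (\sum_(0 <= n < N) c n * (q%:C)%C ^+ n - f (q%:C)%C)).
    by apply/cvg_ex; exists (0 : R).
  exists (B + 1) => N; have := hB (B + 1); rewrite ltrDl ltr01 => /(_ isT N I) /=.
  by rewrite ger0_norm ?cmod_ge0.
have cB n : cmod (c n) * q ^+ n <= B + B.
  have -> : cmod (c n) * q ^+ n = cmod (c n * (q%:C)%C ^+ n).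
    by rewrite cmodM cmodX cmod_real gtr0_norm.
  have -> : c n * (q%:C)%C ^+ n =
    (\sum_(0 <= n < n.+1) c n * (q%:C)%C ^+ n - f (q%:C)%C) -
    (\sum_(0 <= n < n) c n * (q%:C)%C ^+ n - f (q%:C)%C).
    by rewrite big_nat_recr//=; ring.
  exact: le_trans (cmod_le_sub _ _) (lerD (hB _) (hB _)).
have sq0 : 0 <= s / q by rewrite divr_ge0// ltW.
have sq1 : s / q < 1 by rewrite ltr_pdivrMr// mul1r.
have B0 : 0 <= B + B by apply: le_trans (cB 0); rewrite mulr_ge0 ?cmod_ge0// exprn_ge0// ltW.
exists ((B + B) * (1 - s / q)^-1) => N.
apply: le_trans (ler_wpM2l B0 (sum_geometric_le N sq0 sq1)).
rewrite mulr_sumr; apply: ler_sum => n _.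
apply: le_trans (ler_wpM2r (exprn_ge0 n sq0) (cB n)).
by rewrite -mulrA -exprMn mulrCA mulfV ?mulr1 ?gt_eqF.
Qed.

Lemma abs_summable_disk_series c : abs_summable c -> exists f, disk_series f c.
Proof.
move=> h.
exists (fun z => xget 0 [set l | cmod (\sum_(0 <= n < N) c n * z ^+ n - l)
  @[N --> \oo] --> (0 : R)]) => z z1.
have [M hM] := h _ (cmod_ge0 z) z1.
have [|l hl] := @bounded_sum_ccvg (fun n => c n * z ^+ n) M.
  by move=> N; under eq_bigr do rewrite cmodM cmodX.
by case: xgetP => [x _ //|/(_ l)].
Qed.

(** From index N on, |z|^n = (|z|/s)^n s^n is at most (|z|/s)^N s^n, so the tail gains a geometric
    factor over the absolute sum at radius s. *)
Lemma psum_diff_le c (s : R) z N K : 0 < s -> cmod z <= s -> (N <= K)%N ->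
  cmod (\sum_(0 <= n < N) c n * z ^+ n - \sum_(0 <= n < K) c n * z ^+ n) <=
  (cmod z / s) ^+ N * \sum_(0 <= n < K) cmod (c n) * s ^+ n.
Proof.
move=> s0 zs NK; set q := cmod z / s.
have q0 : 0 <= q by rewrite divr_ge0 ?cmod_ge0// ltW.
have q1 : q <= 1 by rewrite ler_pdivrMr// mul1r.
have zq : cmod z = q * s by rewrite divfK// gt_eqF.
have t0 n : 0 <= cmod (c n) * s ^+ n by rewrite mulr_ge0 ?cmod_ge0// exprn_ge0// ltW.
rewrite cmodB (@big_cat_nat _ _ _ N)//= addrAC subrr add0r.
apply: le_trans (cmod_le_sum _ _ _) _.
rewrite [in leRHS](@big_cat_nat _ _ _ N)//= mulrDr.
apply: ler_wpDl; first by rewrite mulr_ge0 ?exprn_ge0// sumr_ge0.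
rewrite mulr_sumr !big_nat; apply: ler_sum => n /andP [Nn nK].
by rewrite cmodM cmodX zq exprMn mulrCA ler_wpM2r// ler_wiXn2l.
Qed.

Lemma disk_series_tail f c (s M : R) z N :
  disk_series f c -> 0 < s -> s < 1 -> cmod z <= s ->
  (forall N, \sum_(0 <= n < N) cmod (c n) * s ^+ n <= M) ->
  cmod (\sum_(0 <= n < N) c n * z ^+ n - f z) <= M * (cmod z / s) ^+ N.
Proof.
move=> hf s0 s1 zs hM.
have h := hf z (le_lt_trans zs s1).
pose S K := \sum_(0 <= n < K) c n * z ^+ n.
have cv : cmod (S N - S K) @[K --> \oo] --> cmod (S N - f z).
  apply: cvg_cmod; have : cmod (S K - f z) @[K --> \oo] --> (0 : R) := h.
  apply: cvg_trans; apply: near_eq_cvg; near=> K.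
  by rewrite (_ : S N - S K - (S N - f z) = f z - S K) 1?cmodB//; ring.
apply: (cvgr_to_le cv); near=> K.
have NK : (N <= K)%N by near: K; exact: nbhs_infty_ge.
apply: le_trans (psum_diff_le _ s0 zs NK) _.
by rewrite mulrC ler_wpM2r// exprn_ge0// divr_ge0 ?cmod_ge0// ltW.
Unshelve. all: by end_near. Qed.

Lemma disk_series_bound f c (s M : R) z :
  disk_series f c -> 0 < s -> s < 1 -> cmod z <= s ->
  (forall N, \sum_(0 <= n < N) cmod (c n) * s ^+ n <= M) -> cmod (f z) <= M.
Proof.
move=> hf s0 s1 zs hM; have := disk_series_tail 0 hf s0 s1 zs hM.
by rewrite big_geq// sub0r cmodN expr0 mulr1.
Qed.

Definition cauchy_prod a b n := \sum_(i < n.+1) a i * b (n - i)%N.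

(** Both sides run over the triangle i + j < N, by antidiagonals on the left and by rows on the
    right. *)
Lemma sum_cauchy_prod (A : comPzRingType) (x y : nat -> A) N :
  \sum_(0 <= n < N) \sum_(i < n.+1) x i * y (n - i)%N =
  \sum_(0 <= i < N) x i * \sum_(0 <= j < N - i) y j.
Proof.
elim: N => [|N IH]; first by rewrite !big_geq.
rewrite big_nat_recr//= IH.
transitivity (\sum_(0 <= i < N.+1) x i * (\sum_(0 <= j < N - i) y j + y (N - i)%N)).
  under [RHS]eq_bigr do rewrite mulrDr.
  rewrite big_split/= [in X in _ = X + _]big_nat_recr//= subnn [in X in _ * X]big_geq//.
  by rewrite mulr0 addr0 -(big_mkord xpredT (fun i => x i * y (N - i)%N)).
rewrite !big_nat; apply: eq_bigr => i /andP[_]; rewrite ltnS => iN.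
by rewrite subSn// big_nat_recr.
Qed.

Lemma psum_cauchy_prod a b z N :
  \sum_(0 <= n < N) cauchy_prod a b n * z ^+ n =
  \sum_(0 <= i < N) a i * z ^+ i * \sum_(0 <= j < N - i) b j * z ^+ j.
Proof.
rewrite -sum_cauchy_prod; apply: eq_bigr => n _; rewrite /cauchy_prod mulr_suml.
apply: eq_bigr => i _; rewrite mulrACA -exprD subnKC// -ltnS; exact: ltn_ord.
Qed.

Lemma abs_summable_cauchy_prod a b (s A B : R) : 0 <= s ->
  (forall N, \sum_(0 <= n < N) cmod (a n) * s ^+ n <= A) ->
  (forall N, \sum_(0 <= n < N) cmod (b n) * s ^+ n <= B) ->
  forall N, \sum_(0 <= n < N) cmod (cauchy_prod a b n) * s ^+ n <= A * B.
Proof.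
move=> s0 hA hB N.
have t0 c n : 0 <= cmod (c n) * s ^+ n by rewrite mulr_ge0 ?cmod_ge0// exprn_ge0.
apply: (@le_trans _ _ (\sum_(0 <= n < N) \sum_(i < n.+1)
   (cmod (a i) * s ^+ i) * (cmod (b (n - i)%N) * s ^+ (n - i)))).
  apply: ler_sum => n _; rewrite /cauchy_prod.
  apply: le_trans (ler_wpM2r (exprn_ge0 n s0) (cmod_le_sum _ _ _)) _.
  rewrite mulr_suml; apply: ler_sum => i _.
  by rewrite mulrACA -exprD subnKC ?cmodM// -ltnS.
rewrite (sum_cauchy_prod (fun i => cmod (a i) * s ^+ i) (fun i => cmod (b i) * s ^+ i)).
have B0 : 0 <= B by apply: le_trans (hB 0); rewrite big_geq.
apply: (@le_trans _ _ (\sum_(0 <= i < N) cmod (a i) * s ^+ i * B)).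
  by apply: ler_sum => i _; rewrite ler_wpM2l.
by rewrite -mulr_suml ler_wpM2r.
Qed.

(** Row i of the triangle misses only the tail of g from N - i on, at most B q^(N-i); multiplied by
    |a_i| s^i q^i, these errors add up to at most A B q^N. *)
Lemma disk_seriesM f g a b : disk_series f a -> disk_series g b ->
  disk_series (fun z => f z * g z) (cauchy_prod a b).
Proof.
move=> hf hg z z1; pose s := (1 + cmod z) / 2.
have z0 := cmod_ge0 z.
have s1 : s < 1 by rewrite /s; lra.
have s0 : 0 < s by rewrite /s; lra.
have zs : cmod z < s by rewrite /s; lra.
have [A hA] := disk_series_abs_summable hf (ltW s0) s1.
have [B hB] := disk_series_abs_summable hg (ltW s0) s1.
pose q := cmod z / s.
have q0 : 0 <= q by rewrite divr_ge0 ?cmod_ge0// ltW.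
have q1 : q < 1 by rewrite ltr_pdivrMr// mul1r.
have zq : cmod z = q * s by rewrite divfK// gt_eqF.
pose X N := \sum_(0 <= n < N) a n * z ^+ n.
have key N : cmod (\sum_(0 <= n < N) cauchy_prod a b n * z ^+ n - X N * g z) <=
    A * B * q ^+ N.
  rewrite psum_cauchy_prod mulr_suml -sumrB; apply: le_trans (cmod_le_sum _ _ _) _.
  have B0 : 0 <= B by apply: le_trans (hB 0); rewrite big_geq.
  apply: (@le_trans _ _ (\sum_(0 <= i < N) cmod (a i) * s ^+ i * (B * q ^+ N))).
    rewrite !big_nat; apply: ler_sum => i /andP[_ iN].
    rewrite -mulrBr cmodM cmodM cmodX.
    have := disk_series_tail (N - i) hg s0 s1 (ltW zs) hB; rewrite -/q => h.
    apply: le_trans (ler_wpM2l _ h) _; first by rewrite mulr_ge0 ?exprn_ge0 ?cmod_ge0.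
    rewrite zq exprMn le_eqVlt; apply/orP; left; apply/eqP.
    have -> : q ^+ N = q ^+ i * q ^+ (N - i) by rewrite -exprD subnKC// ltnW.
    by ring.
  rewrite -mulr_suml -mulrA ler_wpM2r// mulr_ge0// exprn_ge0//.
have c1 : cmod (X N * g z - f z * g z) @[N --> \oo] --> (0 : R).
  by apply: ccvgM; [exact: hf|exact: ccvg_cst].
have c2 : A * B * q ^+ N @[N --> \oo] --> A * B * (0 : R).
  by apply: cvgMr; apply: cvg_expr; rewrite ger0_norm.
have c3 : (A * B * q ^+ N + cmod (X N * g z - f z * g z)) @[N --> \oo] --> (0 : R).
  by rewrite -[X in _ --> X](addr0 (0 : R)) -{1}(mulr0 (A * B)); exact: cvgD.
apply: (squeeze_cvgr _ (cvg_cst (0 : R)) c3).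
near=> N; rewrite cmod_ge0 /=.
have -> : \sum_(0 <= n < N) cauchy_prod a b n * z ^+ n - f z * g z =
  (\sum_(0 <= n < N) cauchy_prod a b n * z ^+ n - X N * g z) + (X N * g z - f z * g z) by ring.
exact: le_trans (cmod_le_add _ _) (lerD (key N) (lexx _)).
Unshelve. all: by end_near. Qed.

Definition unit_coef n : C := (n == 0%N)%:R.

Fixpoint cauchy_pow a k := if k is k'.+1 then cauchy_prod a (cauchy_pow a k') else unit_coef.

Lemma sum_unit_coef (F : nat -> C) N :
  \sum_(0 <= n < N.+1) unit_coef n * F n = F 0%N.
Proof.
rewrite big_nat_recl//= big1 ?addr0 ?mul1r// => i _.
by rewrite /unit_coef /= mul0r.
Qed.

Lemma disk_series1 : disk_series (fun=> 1) unit_coef.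
Proof.
move=> z _; apply: cvg_near_cst; near=> N.
have N0 : (0 < N)%N by near: N; exact: nbhs_infty_gt.
by rewrite -(prednK N0) sum_unit_coef expr0 subrr cmod0.
Unshelve. all: by end_near. Qed.

Lemma disk_seriesX f a k : disk_series f a ->
  disk_series (fun z => f z ^+ k) (cauchy_pow a k).
Proof.
move=> hf; elim: k => [|k IH] /=; first exact: disk_series1.
by under eq_fun do rewrite exprS; exact: disk_seriesM.
Qed.

Lemma abs_summable_cauchy_pow a (s A : R) k : 0 <= s ->
  (forall N, \sum_(0 <= n < N) cmod (a n) * s ^+ n <= A) ->
  forall N, \sum_(0 <= n < N) cmod (cauchy_pow a k n) * s ^+ n <= A ^+ k.
Proof.
move=> s0 hA; elim: k => [|k IH] N /=.
  case: N => [|N]; first by rewrite big_geq.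
rewrite big_nat_recl//= big1 ?addr0; first by rewrite (_ : unit_coef 0 = 1) // cmod1 mul1r expr0.
  by move=> i _; rewrite (_ : unit_coef i.+1 = 0) // cmod0 mul0r.
by rewrite exprS; exact: abs_summable_cauchy_prod.
Qed.

Lemma disk_series_scale f a (r : R) : 0 <= r -> r <= 1 -> disk_series f a ->
  disk_series (fun z => f ((r%:C)%C * z)) (fun n => a n * (r%:C)%C ^+ n).
Proof.
move=> r0 r1 hf z z1.
under eq_fun => N do under eq_bigr => n _ do rewrite -mulrA -exprMn.
apply: hf; rewrite cmodM cmod_real ger0_norm//.
by apply: le_lt_trans z1; rewrite ler_piMl// cmod_ge0.
Qed.

Lemma disk_seriesZ f a (k : C) : disk_series f a ->
  disk_series (fun z => k * f z) (fun n => k * a n).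
Proof.
move=> hf z z1.
under eq_fun => N do under eq_bigr => n _ do rewrite -mulrA.
under eq_fun => N do rewrite -mulr_sumr -mulrBr cmodM.
by rewrite -(mulr0 (cmod k)); apply: cvgMr; exact: hf.
Qed.

(* Interchange of two summations: a geometric gain [(|z|/s)^N] in the inner tails,
   uniform in the number [K] of outer terms, replaces Fubini for series. *)
Lemma disk_series_series (G : nat -> C -> C) (b : nat -> nat -> C) (d : nat -> C) f :
  (forall k, disk_series (G k) (b k)) ->
  (forall s : R, 0 <= s -> s < 1 -> exists M, forall K N,
     \sum_(0 <= k < K) cmod (d k) * \sum_(0 <= n < N) cmod (b k n) * s ^+ n <= M) ->
  (forall z, cmod z < 1 ->
     cmod (\sum_(0 <= k < K) d k * G k z - f z) @[K --> \oo] --> (0 : R)) ->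
  exists e, disk_series f e /\
    forall n, cmod (\sum_(0 <= k < K) d k * b k n - e n) @[K --> \oo] --> (0 : R).
Proof.
move=> hG hM hf.
have he n : exists e, cmod (\sum_(0 <= k < K) d k * b k n - e) @[K --> \oo] --> (0 : R).
  (* One positive radius is enough for the coefficient series to converge: at 1/2, the n-th
     coefficients are controlled up to the factor 2^n. *)
  have [||M hMM] := hM 2^-1; [lra|lra|].
  apply: (@bounded_sum_ccvg _ (M * 2 ^+ n)) => K.
  rewrite -ler_pdivrMr ?exprn_gt0// mulr_suml; apply: le_trans (hMM K n.+1).
  apply: ler_sum => k _; rewrite cmodM -mulrA ler_wpM2l ?cmod_ge0//.
  rewrite big_nat_recr//= -exprVn lerDr sumr_ge0// => i _.
  by rewrite mulr_ge0 ?cmod_ge0// exprn_ge0// invr_ge0.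
have [e {}he] := choice he; exists e; split => // z z1.
pose s := (1 + cmod z) / 2.
have z0 := cmod_ge0 z.
have s1 : s < 1 by rewrite /s; lra.
have s0 : 0 < s by rewrite /s; lra.
have zs : cmod z < s by rewrite /s; lra.
have [M hMM] := hM _ (ltW s0) s1.
pose q := cmod z / s.
have q0 : 0 <= q by rewrite divr_ge0 ?cmod_ge0// ltW.
have q1 : q < 1 by rewrite ltr_pdivrMr// mul1r.
(* Two limits in turn: K to infinity reduces [e] and [f] to finite combinations over k, then J to
   infinity reduces each [G k] to a partial sum, where [psum_diff_le] applies. *)
have key N : cmod (\sum_(0 <= n < N) e n * z ^+ n - f z) <= M * q ^+ N.
  have c1 : cmod ((\sum_(0 <= n < N) (\sum_(0 <= k < K) d k * b k n) * z ^+ n)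
      - \sum_(0 <= n < N) e n * z ^+ n) @[K --> \oo] --> (0 : R).
    by apply: ccvg_sum => i; apply: ccvgM; [exact: he|exact: ccvg_cst].
  have c2 : cmod (- (\sum_(0 <= k < K) d k * G k z) - - f z) @[K --> \oo] --> (0 : R).
    by under eq_fun do rewrite -opprD cmodN; exact: hf.
  have c12 : cmod ((\sum_(0 <= n < N) (\sum_(0 <= k < K) d k * b k n) * z ^+ n)
      - \sum_(0 <= k < K) d k * G k z) @[K --> \oo] -->
      cmod (\sum_(0 <= n < N) e n * z ^+ n - f z).
    by apply: cvg_cmod; exact: ccvgD.
  apply: (cvgr_to_le c12); near=> K.
  have -> : \sum_(0 <= n < N) (\sum_(0 <= k < K) d k * b k n) * z ^+ n =
      \sum_(0 <= k < K) d k * \sum_(0 <= n < N) b k n * z ^+ n.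
    under eq_bigr do rewrite mulr_suml.
    rewrite exchange_big /=; apply: eq_bigr => k _.
    by rewrite mulr_sumr; apply: eq_bigr => n _; rewrite mulrA.
  have c3 : cmod (\sum_(0 <= k < K) d k * (\sum_(0 <= n < N) b k n * z ^+ n
      - \sum_(0 <= n < J) b k n * z ^+ n) -
      \sum_(0 <= k < K) d k * (\sum_(0 <= n < N) b k n * z ^+ n - G k z))
      @[J --> \oo] --> (0 : R).
    apply: ccvg_sum => k; apply: ccvgM; first exact: ccvg_cst.
    apply: ccvgD; first exact: ccvg_cst.
    by under eq_fun do rewrite -opprD cmodN; exact: hG.
  rewrite -sumrB; under eq_bigr do rewrite -mulrBr.
  apply: cvgr_to_le (cvg_cmod c3) _; near=> J.
  have NJ : (N <= J)%N by near: J; exact: nbhs_infty_ge.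
  apply: le_trans (cmod_le_sum _ _ _) _.
  apply: le_trans (ler_wpM2r (exprn_ge0 N q0) (hMM K J)).
  rewrite mulr_suml; apply: ler_sum => k _.
  rewrite cmodM -mulrA ler_wpM2l ?cmod_ge0// mulrC.
  exact: psum_diff_le (ltW zs) NJ.
apply: (squeeze_cvgr _ (cvg_cst (0 : R))); last first.
  rewrite -(mulr0 M); apply: cvgMr; apply: (@cvg_expr _ q); by rewrite ger0_norm.
by near=> N; rewrite cmod_ge0 key.
Unshelve. all: by end_near. Qed.

End PowerSeries.

(** * The complex exponential and its composition with analytic functions *)

Section ComplexExponential.
Variable R : realType.
Local Notation C := R[i].
Implicit Types (c a b : nat -> C) (f g : C -> C) (z : C).

Lemma disk_series0 f c : disk_series f c -> c 0%N = f 0.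
Proof.
move=> hf; have z0 : cmod (0 : C) < 1 by rewrite cmod0.
apply: (@ccvg_unique R nat \oo _ (fun N => \sum_(0 <= n < N) c n * 0 ^+ n)); last exact: hf.
apply: cvg_near_cst; near=> N.
have N0 : (0 < N)%N by near: N; exact: nbhs_infty_gt.
rewrite -(prednK N0) big_nat_recl//= expr0 mulr1 big1 ?addr0 ?subrr ?cmod0// => i _.
by rewrite exprS mul0r mulr0.
Unshelve. all: by end_near. Qed.

(** The tails are uniformly small on a disk of radius r containing l in its interior, so one
    polynomial carries the limit. *)
Lemma disk_series_continuous (T : Type) (F : set_system T) {FF : ProperFilter F}
    (u : T -> C) (l : C) f c :
  disk_series f c -> cmod l < 1 ->
  (cmod (u x - l) @[x --> F] --> (0 : R)) ->
  (cmod (f (u x) - f l) @[x --> F] --> (0 : R)).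
Proof.
move=> hf l1 hu; have l0 := cmod_ge0 l.
(* Equally spaced radii between |l| and 1: r leaves room for [u x], and r/s is the ratio of the
   tails. *)
have [r [s [lr rs s1]]] : exists r s : R, [/\ cmod l < r, r < s & s < 1].
  by exists ((1 + 2 * cmod l) / 3), ((2 + cmod l) / 3); split; lra.
have s0 : 0 < s by lra.
have [M hM] := disk_series_abs_summable hf (ltW s0) s1.
have M0 : 0 <= M by apply: le_trans (hM 0); rewrite big_geq.
have q1 : r / s < 1 by rewrite ltr_pdivrMr// mul1r.
have q0 : 0 <= r / s by rewrite divr_ge0//; lra.
have tl z N : cmod z <= r ->
    cmod (\sum_(0 <= n < N) c n * z ^+ n - f z) <= M * (r / s) ^+ N.
  move=> zr; apply: le_trans (disk_series_tail N hf s0 s1 _ hM) _; first lra.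
  rewrite ler_wpM2l//; apply: lerXn2r => //; rewrite ?nnegrE//.
    by rewrite divr_ge0 ?cmod_ge0 ?ltW.
  by rewrite ler_pM2r// invr_gt0.
apply/cvgrPdist_lt => e e0.
have [N hN] : exists N, M * (r / s) ^+ N < e / 3.
  have c0 : M * (r / s) ^+ N @[N --> \oo] --> (0 : R).
    by rewrite -(mulr0 M); apply: cvgMr; apply: cvg_expr; rewrite ger0_norm.
  have e3 : 0 < e / 3 by rewrite divr_gt0.
  have [N _ hN] := (cvgr_lt _ c0 _ e3); exists N; exact: hN (leqnn N).
have ur : \forall x \near F, cmod (u x) < r.
  by move: lr; apply: cvgr_lt; exact: cvg_cmod.
have pc : (cmod (\sum_(0 <= n < N) c n * u x ^+ n - \sum_(0 <= n < N) c n * l ^+ n)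
    @[x --> F] --> (0 : R)).
  by apply: ccvg_sum => n; apply: ccvgM; [exact: ccvg_cst|exact: ccvgX].
have pe : \forall x \near F,
    cmod (\sum_(0 <= n < N) c n * u x ^+ n - \sum_(0 <= n < N) c n * l ^+ n) < e / 3.
  by apply: (cvgr_lt _ pc); rewrite divr_gt0.
near=> x.
rewrite sub0r normrN ger0_norm ?cmod_ge0//.
have -> : f (u x) - f l = - (\sum_(0 <= n < N) c n * u x ^+ n - f (u x)) +
   (\sum_(0 <= n < N) c n * u x ^+ n - \sum_(0 <= n < N) c n * l ^+ n) +
   (\sum_(0 <= n < N) c n * l ^+ n - f l) by ring.
have h1 : cmod (- (\sum_(0 <= n < N) c n * u x ^+ n - f (u x))) < e / 3.
  rewrite cmodN; apply: le_lt_trans hN; apply: tl; apply: ltW.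
  by near: x.
have h2 : cmod (\sum_(0 <= n < N) c n * u x ^+ n - \sum_(0 <= n < N) c n * l ^+ n) < e / 3.
  by near: x.
have h3 : cmod (\sum_(0 <= n < N) c n * l ^+ n - f l) < e / 3.
  by apply: le_lt_trans hN; apply: tl; exact: ltW.
apply: le_lt_trans (cmod_le_add _ _) _.
apply: le_lt_trans (lerD (cmod_le_add _ _) (lexx _)) _.
by apply: lt_le_trans (ltrD (ltrD h1 h2) h3) _; lra.
Unshelve. all: by end_near. Qed.

Definition ecoef n : C := (((n`!%:R)^-1 : R)%:C)%C.

Definition cexp z : C := xget 0 [set l |
  cmod (\sum_(0 <= k < K) ecoef k * z ^+ k - l) @[K --> \oo] --> (0 : R)].

Lemma cmod_ecoef n : cmod (ecoef n) = (n`!%:R)^-1.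
Proof. by rewrite cmod_real ger0_norm// invr_ge0. Qed.

Lemma sum_exp_le (x : R) K : 0 <= x ->
  \sum_(0 <= k < K) (k`!%:R)^-1 * x ^+ k <= expR x.
Proof.
move=> x0; have := is_cvg_series_exp_coeff x.
have nd : {homo series (exp_coeff x) : n m / (n <= m)%N >-> n <= m}.
  apply/nondecreasing_seqP => n; rewrite /series /= big_nat_recr//= lerDl.
  by rewrite /exp_coeff /= divr_ge0// exprn_ge0.
move=> /(nondecreasing_cvgn_le nd) /(_ K); apply: le_trans.
by rewrite /series /=; apply: ler_sum => k _; rewrite /exp_coeff /= mulrC.
Qed.

Lemma cexp_cvg z :
  cmod (\sum_(0 <= k < K) ecoef k * z ^+ k - cexp z) @[K --> \oo] --> (0 : R).
Proof.
have [|l hl] := @bounded_sum_ccvg _ (fun n => ecoef n * z ^+ n) (expR (cmod z)).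
  move=> N; under eq_bigr do rewrite cmodM cmodX cmod_ecoef.
  exact/sum_exp_le/cmod_ge0.
by rewrite /cexp; case: xgetP => [x _ //|/(_ l)].
Qed.

Lemma cexp_unique z l :
  cmod (\sum_(0 <= k < K) ecoef k * z ^+ k - l) @[K --> \oo] --> (0 : R) -> cexp z = l.
Proof. by move=> h; apply: ccvg_unique (cexp_cvg z) h. Qed.

Lemma cexp_conj z : cexp (z^*)%C = ((cexp z)^*)%C.
Proof.
apply: cexp_unique.
have E K : \sum_(0 <= k < K) ecoef k * ((z^*)%C) ^+ k - ((cexp z)^*)%C =
    ((\sum_(0 <= k < K) ecoef k * z ^+ k - cexp z)^*)%C.
  rewrite rmorphB rmorph_sum /=; congr (_ - _); apply: eq_bigr => k _.
  by rewrite rmorphM rmorphXn; congr (_ * _); symmetry; exact: conjc_real.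
by under eq_fun => K do rewrite E cmod_conj; exact: cexp_cvg.
Qed.

Lemma cexp_real (x : R) : cexp (x%:C)%C = ((expR x)%:C)%C.
Proof.
apply: cexp_unique.
have := is_cvg_series_exp_coeff x; rewrite -/(expR x) => h.
have h2 : `|series (exp_coeff x) K - expR x| @[K --> \oo] --> (0 : R).
  by rewrite -(normr0 R) -(subrr (expR x)); apply: cvg_norm; apply: cvgB => //; exact: cvg_cst.
apply: cvg_trans h2; apply: near_eq_cvg; near=> K.
rewrite -cmod_real rmorphB; congr (cmod (_ - _)); rewrite /series /= rmorph_sum.
by apply: eq_bigr => k _; rewrite /exp_coeff /= mulrC rmorphM rmorphXn.
Unshelve. all: by end_near. Qed.

(** On the complex line spanned by z the exponential is a power series in s, which turns the
    addition formula into a Cauchy product. *)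
Lemma disk_series_cexp_line z :
  disk_series (fun s => cexp (s * z)) (fun k => ecoef k * z ^+ k).
Proof.
move=> s _; under eq_fun => K do under eq_bigr => k _ do
  rewrite -mulrA -exprMn [z * s]mulrC.
exact: cexp_cvg.
Qed.

Lemma cauchy_prod_ecoef z w n :
  cauchy_prod (fun k => ecoef k * z ^+ k) (fun k => ecoef k * w ^+ k) n = ecoef n * (z + w) ^+ n.
Proof.
rewrite /cauchy_prod addrC exprDn mulr_sumr; apply: eq_bigr => i _.
have E : ecoef i * ecoef (n - i) = ecoef n * 'C(n, i)%:R.
  have ni : (i <= n)%N by rewrite -ltnS.
  have -> : ('C(n, i)%:R : C) = (('C(n, i)%:R : R)%:C)%C by rewrite rmorph_nat.
  rewrite /ecoef -!rmorphM /=; congr (_%:C)%C.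
  have f0 k : (k`!%:R : R) != 0 by rewrite pnatr_eq0 -lt0n fact_gt0.
  apply: (mulfI (f0 n)); rewrite [RHS]mulrA mulfV// mul1r -(bin_fact ni) !natrM.
  by field; rewrite !f0.
by rewrite mulrACA E -mulr_natr -!mulrA; congr (_ * _); ring.
Qed.

(** Cauchy products are evaluated only at points of modulus below 1, so the formula is read at s =
    1/2 on the lines through 2z and 2w. *)
Lemma cexpD z w : cexp (z + w) = cexp z * cexp w.
Proof.
have h1 := disk_seriesM (disk_series_cexp_line (2 * z)) (disk_series_cexp_line (2 * w)).
have h2 := disk_series_cexp_line (2 * z + 2 * w).
have half : cmod (2^-1 : C) < 1.
  have -> : (2^-1 : C) = ((2^-1 : R)%:C)%C by rewrite fmorphV rmorph_nat.
  by rewrite cmod_real ger0_norm; lra.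
have := h1 _ half; under eq_fun => N do under eq_bigr => n _ do rewrite cauchy_prod_ecoef.
move=> /(ccvg_unique (h2 _ half)).
have t0 : (2 : C) != 0 by rewrite pnatr_eq0.
by rewrite mulrDr !mulKf.
Qed.

(** The exponential of z times its conjugate is the exponential of the real number 2 Re z. *)
Lemma cmod_cexp z : cmod (cexp z) ^+ 2 = expR (2 * Re z).
Proof.
have := mulc_conj (cexp z); rewrite -cexp_conj -cexpD.
have -> : z + (z^*)%C = ((2 * Re z)%:C)%C by rewrite addcJ rmorphM /= rmorph_nat.
by rewrite cexp_real => - [].
Qed.

(** If A bounds the absolute sums of f at radius s, those of f^k are bounded by A^k, and the sum of
    A^k / k! stays below exp A: the series of power series can be interchanged. *)
Lemma disk_series_cexp f a : disk_series f a -> analytic_on_disk (fun z => cexp (f z)).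
Proof.
move=> hf.
have [k|s s0 s1|z z1|e [he _]] := @disk_series_series _ (fun k z => f z ^+ k)
  (cauchy_pow a) ecoef (fun z => cexp (f z)).
- exact: disk_seriesX.
- have [A hA] := disk_series_abs_summable hf s0 s1.
  exists (expR A) => K N.
  have A0 : 0 <= A by apply: le_trans (hA 0); rewrite big_geq.
  apply: le_trans (sum_exp_le K A0); apply: ler_sum => k _.
  by rewrite cmod_ecoef ler_wpM2l ?invr_ge0//; exact: abs_summable_cauchy_pow.
- exact: cexp_cvg.
- by exists e.
Qed.

End ComplexExponential.

(** * Normalised integrals over one period, and dominated convergence for them *)

Section Mean.
Variable R : realType.
Local Notation mu := (@lebesgue_measure R).
Implicit Types f g : R -> R.

Lemma ae_imp (P Q : R -> Prop) : (forall t, P t -> Q t) ->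
  {ae mu, forall t, P t} -> {ae mu, forall t, Q t}.
Proof.
move=> PQ [N [mN N0 sub]]; exists N; split => // t nQ; apply: sub => /= Pt.
by apply: nQ; exact: PQ.
Qed.

Lemma ae_and (P Q : R -> Prop) :
  {ae mu, forall t, P t} -> {ae mu, forall t, Q t} -> {ae mu, forall t, P t /\ Q t}.
Proof.
move=> [N [mN N0 subN]] [M [mM M0 subM]]; exists (N `|` M); split.
- exact: measurableU.
- by rewrite measureU0.
- move=> t /= nPQ; have [Pt|nP] := pselect (P t); last by left; exact: subN.
  by right; apply: subM => /= Qt; apply: nPQ.
Qed.

Definition circle : set R := `[0%R, (2 * pi)%R].

Definition circle_integrable f := mu.-integrable circle (EFin \o f).

Definition mean f : R := (2 * pi)^-1 * (\int[mu]_(x in circle) f x)%R.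

(** Measurability and the bound are global, which makes this an algebra of functions acting by
    multiplication on the integrable ones. *)
Definition bounded_measurable f :=
  measurable_fun setT f /\ exists M : R, forall t, `|f t| <= M.

Lemma pi2_gt0 : 0 < 2 * pi :> R. Proof. by rewrite mulr_gt0// pi_gt0. Qed.

Lemma measurable_circle : measurable circle. Proof. exact: measurable_itv. Qed.

Lemma mu_circle : mu circle = (2 * pi)%:E.
Proof. by rewrite /circle lebesgue_measure_itv /= lte_fin pi2_gt0 -EFinB subr0. Qed.

Lemma bmP f M : measurable_fun setT f -> (forall t, `|f t| <= M) -> bounded_measurable f.
Proof. by move=> mf h; split => //; exists M. Qed.

Lemma bm_integrable f : bounded_measurable f -> circle_integrable f.
Proof.
move=> [mf [M hM]]; apply: measurable_bounded_integrable.
- exact: measurable_circle.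
- by rewrite [X in (X < _)%E]mu_circle ltry.
- exact: measurable_funTS.
- exists M; split; first exact: num_real.
  by move=> x Mx t _ /=; apply: le_trans (hM t) (ltW Mx).
Qed.

Lemma bm_cst k : bounded_measurable (fun=> k).
Proof. by apply: (@bmP _ `|k|). Qed.

Lemma bmD f g : bounded_measurable f -> bounded_measurable g ->
  bounded_measurable (fun t => f t + g t).
Proof.
move=> [mf [M hM]] [mg [N hN]]; apply: (@bmP _ (M + N)); first exact: measurable_funD.
by move=> t; apply: le_trans (ler_normD _ _) (lerD (hM t) (hN t)).
Qed.

Lemma bmN f : bounded_measurable f -> bounded_measurable (fun t => - f t).
Proof.
move=> [mf [M hM]]; apply: (@bmP _ M); last by move=> t; rewrite normrN.
exact: measurableT_comp.
Qed.

Lemma bmM f g : bounded_measurable f -> bounded_measurable g ->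
  bounded_measurable (fun t => f t * g t).
Proof.
move=> [mf [M hM]] [mg [N hN]]; apply: (@bmP _ (M * N)); first exact: measurable_funM.
by move=> t; rewrite normrM ler_pM.
Qed.

Lemma bmZ k f : bounded_measurable f -> bounded_measurable (fun t => k * f t).
Proof. by apply: bmM; exact: bm_cst. Qed.

Lemma bm_sum (F : nat -> R -> R) N :
  (forall n, bounded_measurable (F n)) ->
  bounded_measurable (fun t => \sum_(0 <= n < N) F n t).
Proof.
move=> h; elim: N => [|N IH].
  by under eq_fun do rewrite big_geq//; exact: bm_cst.
by under eq_fun do rewrite big_nat_recr//=; exact: bmD.
Qed.

Lemma ciD f g : circle_integrable f -> circle_integrable g ->
  circle_integrable (fun t => f t + g t).
Proof.
move=> hf hg; have := @integrableD _ _ _ mu circle measurable_circle _ _ hf hg.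
by rewrite /circle_integrable; congr integrable; apply/funext => x /=; rewrite EFinD.
Qed.

Lemma ciZ k f : circle_integrable f -> circle_integrable (fun t => k * f t).
Proof.
move=> hf; have := @integrableZl _ _ _ mu circle measurable_circle k _ hf.
by rewrite /circle_integrable; congr integrable; apply/funext => x /=; rewrite EFinM.
Qed.

Lemma ciN f : circle_integrable f -> circle_integrable (fun t => - f t).
Proof. by move=> /(ciZ (-1)); under eq_fun do rewrite mulN1r. Qed.

Lemma ciM f g : circle_integrable f -> bounded_measurable g ->
  circle_integrable (fun t => g t * f t).
Proof.
move=> hf [mg [M hM]].
have hM' := ciZ M hf.
have mf : measurable_fun circle f.
  by have /integrableP [/measurable_EFinP] := hf.
apply: (@le_integrable _ _ _ mu circle measurable_circle _ _ _ _ hM').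
  by apply/measurable_EFinP; apply: measurable_funM => //; exact: measurable_funTS.
move=> x _ /=; rewrite lee_fin !normrM ler_wpM2r//.
by apply: le_trans (hM x) (ler_norm _).
Qed.

Lemma ci_sum (F : nat -> R -> R) N :
  (forall n, circle_integrable (F n)) ->
  circle_integrable (fun t => \sum_(0 <= n < N) F n t).
Proof.
move=> h; elim: N => [|N IH].
  by under eq_fun do rewrite big_geq//; exact/bm_integrable/bm_cst.
by under eq_fun do rewrite big_nat_recr//=; exact: ciD.
Qed.

Lemma mean_cst k : mean (fun=> k) = k.
Proof.
rewrite /mean Rintegral_cst; last exact: measurable_circle.
by rewrite [X in fine X]mu_circle /= mulrC mulfK// gt_eqF ?pi2_gt0.
Qed.

Lemma meanD f g : circle_integrable f -> circle_integrable g ->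
  mean (fun t => f t + g t) = mean f + mean g.
Proof. by move=> hf hg; rewrite /mean RintegralD ?mulrDr//; exact: measurable_circle. Qed.

Lemma meanZ k f : circle_integrable f -> mean (fun t => k * f t) = k * mean f.
Proof. by move=> hf; rewrite /mean RintegralZl 1?mulrCA//; exact: measurable_circle. Qed.

Lemma meanN f : circle_integrable f -> mean (fun t => - f t) = - mean f.
Proof. by move=> hf; under eq_fun do rewrite -mulN1r; rewrite meanZ// mulN1r. Qed.

Lemma mean_sum (F : nat -> R -> R) N :
  (forall n, circle_integrable (F n)) ->
  mean (fun t => \sum_(0 <= n < N) F n t) = \sum_(0 <= n < N) mean (F n).
Proof.
move=> h; elim: N => [|N IH].
  by under eq_fun do rewrite big_geq//; rewrite mean_cst big_geq.
under eq_fun do rewrite big_nat_recr//=.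
by rewrite meanD ?IH ?big_nat_recr//; exact: ci_sum.
Qed.

Lemma eq_mean f g : (forall t, f t = g t) -> mean f = mean g.
Proof. by move=> /funext ->. Qed.

Lemma mean_le f g : circle_integrable f -> circle_integrable g ->
  (forall t, circle t -> f t <= g t) -> mean f <= mean g.
Proof.
move=> hf hg h; rewrite /mean ler_wpM2l ?invr_ge0 ?(ltW pi2_gt0)//.
by apply: le_Rintegral => //; exact: measurable_circle.
Qed.

Lemma mean_ge0 f : (forall t, circle t -> 0 <= f t) -> 0 <= mean f.
Proof.
move=> h; rewrite /mean mulr_ge0 ?invr_ge0 ?(ltW pi2_gt0)//.
by apply: Rintegral_ge0 => // x /set_mem; exact: h.
Qed.

Lemma ci_norm f : circle_integrable f -> circle_integrable (fun t => `|f t|).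
Proof.
by move=> hf; have := integrable_norm hf; rewrite /circle_integrable; congr integrable.
Qed.

Lemma mean_norm_le f : circle_integrable f -> `|mean f| <= mean (fun t => `|f t|).
Proof.
move=> hf; rewrite /mean normrM gtr0_norm ?invr_gt0 ?pi2_gt0//.
rewrite ler_wpM2l ?invr_ge0 ?(ltW pi2_gt0)//.
by apply: le_normr_Rintegral => //; exact: measurable_circle.
Qed.

Lemma meanE f : circle_integrable f ->
  (\int[mu]_(x in circle) (f x)%:E = (2 * pi * mean f)%:E)%E.
Proof.
move=> hf; rewrite /mean mulVKf ?gt_eqF ?pi2_gt0// /Rintegral fineK//.
exact: (@integrable_fin_num _ _ _ mu circle measurable_circle _ hf).
Qed.

Lemma mean_bounded_cvg (F : nat -> R -> R) f M :
  (forall n, measurable_fun setT (F n)) -> measurable_fun setT f ->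
  (forall n t, `|F n t| <= M) ->
  {ae mu, forall t, circle t -> F n t @[n --> \oo] --> f t} ->
  mean (F n) @[n --> \oo] --> mean f.
Proof.
move=> mF mf hM hcv.
have bmF n : bounded_measurable (F n) by apply: (@bmP _ M).
have [|||||intf _ h] := @dominated_convergence _ _ _ mu circle measurable_circle
  (fun n x => (F n x)%:E) (EFin \o f) (cst M%:E).
- by move=> n; apply/measurable_EFinP; apply: measurable_funTS; exact: mF.
- by apply/measurable_EFinP; exact: measurable_funTS.
- apply: ae_imp hcv => t h ct; apply: cvg_EFin; [exact: nearW|exact: h].
- exact: (bm_integrable (bm_cst M)).
- by apply: aeW => t n _ /=; rewrite lee_fin.
rewrite /mean; apply: cvgMr; rewrite /Rintegral.
apply: fine_cvg; rewrite fineK //.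
exact: (@integrable_fin_num _ _ _ mu circle measurable_circle _ intf).
Qed.

(** The function max(f, g) dominates f everywhere and equals g almost everywhere, which reduces the
    claim to a pointwise comparison. *)
Lemma mean_le_ae f g : circle_integrable f -> circle_integrable g ->
  {ae mu, forall t, circle t -> f t <= g t} -> mean f <= mean g.
Proof.
move=> hf hg h; rewrite /mean ler_wpM2l ?invr_ge0 ?(ltW pi2_gt0)//.
have mc := measurable_circle.
have mf : measurable_fun circle f by have /integrableP [/measurable_EFinP] := hf.
have mg : measurable_fun circle g by have /integrableP [/measurable_EFinP] := hg.
apply: (@le_trans _ _ (\int[mu]_(x in circle) Num.max (f x) (g x))%R).
- apply: le_Rintegral => //; last by move=> x _; rewrite le_max lexx.
  apply: (@le_integrable _ _ _ mu circle mc _ _ _ _ (ciD (ci_norm hf) (ci_norm hg))).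
    by apply/measurable_EFinP; exact: measurable_maxr.
  move=> x _ /=; rewrite lee_fin [leRHS]ger0_norm ?addr_ge0//.
  by case: (leP (f x) (g x)) => _; rewrite ?lerDl ?lerDr.
- rewrite /Rintegral le_eqVlt; apply/orP; left; apply/eqP; congr fine.
  apply: ae_eq_integral => //.
  + by apply/measurable_EFinP; exact: measurable_maxr.
  + exact/measurable_EFinP.
  + apply: ae_imp h => t h ct /=; congr EFin; apply/max_idPr; exact: h.
Qed.

End Mean.

(** * Monotonicity of the integral without measurability *)

Section IntegralNonMeasurable.
Context d (T : measurableType d) (R : realType) (mu : {measure set T -> \bar R}).

(** The integral of a nonnegative function is a supremum over the simple functions below it, and
    this set grows with the function. It is applied to [log_integrand]. *)
Lemma ge0_le_integral_nonmeasurable (D : set T) (f g : T -> \bar R) :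
  (forall x, D x -> (0 <= f x)%E) -> (forall x, D x -> (f x <= g x)%E) ->
  (\int[mu]_(x in D) f x <= \int[mu]_(x in D) g x)%E.
Proof.
move=> f0 fg; have g0 x : D x -> (0 <= g x)%E by move=> Dx; apply: le_trans (fg _ Dx); exact: f0.
rewrite !ge0_integralE//; apply: le_ereal_sup => _ [h hf <-]; exists h => // x.
by apply: le_trans (hf x) _; exact: lee_restrict.
Qed.

End IntegralNonMeasurable.

(** * Orthogonality of trigonometric monomials and Parseval's identity *)

Section Trigonometric.
Variable R : realType.
Local Notation C := R[i].
Local Notation mu := (@lebesgue_measure R).

Lemma cmod_expi (t : R) : cmod (expi t) = 1.
Proof. by rewrite /cmod /expi /= cos2Dsin2 sqrtr1. Qed.

Lemma expi_conj (t : R) : expi t * ((expi t)^*)%C = 1.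
Proof. by rewrite mulc_conj cmod_expi expr1n. Qed.

Lemma expiX (t : R) n : expi t ^+ n = expi (n%:R * t).
Proof.
elim: n => [|n IH]; first by rewrite mul0r expr0 /expi cos0 sin0.
rewrite exprS IH -natr1 mulrDl mul1r /expi addrC cosD sinD.
by apply/eqP; rewrite eq_complex /= [sin t * _ + _]addrC !eqxx.
Qed.

Lemma cmod_circle (r t : R) : 0 <= r -> cmod ((r%:C)%C * expi t) = r.
Proof. by move=> r0; rewrite cmodM cmod_expi mulr1 cmod_real ger0_norm. Qed.

Lemma is_derive_scale (k x : R) (f : R -> R) (df : R) :
  is_derive (k * x) 1 f df -> is_derive x 1 (fun y => f (k * y)) (k * df).
Proof.
move=> h; have hk : is_derive x 1 (fun y : R => k * y) k.
  by apply: is_derive_eq; rewrite /GRing.scale /= mulr1.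
have := @is_derive1_comp R f (fun y => k * y) x df k h hk.
by rewrite mulrC.
Qed.

Lemma circle_integral_derive (f F : R -> R) :
  continuous f -> (forall x : R, is_derive x 1 F (f x)) -> F (2 * pi) = F 0 ->
  mean f = 0.
Proof.
move=> cf dF FE; rewrite /mean /Rintegral.
rewrite (@continuous_FTC2 R f F 0 (2 * pi)) ?pi2_gt0//.
- by rewrite FE -EFinB subrr mulr0.
- exact: continuous_subspaceT.
- have cF x : {for x, continuous F}.
    by apply: differentiable_continuous; apply/derivable1_diffP.
  split => //.
  - exact: cvg_at_right_filter (cF 0).
  - exact: cvg_at_left_filter (cF (2 * pi)).
- by move=> x _; rewrite derive1E; exact: derive_val.
Qed.

Lemma mean_cos n : (0 < n)%N -> mean (fun t : R => cos (n%:R * t)) = 0.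
Proof.
move=> n0; have n1 : (n%:R : R) != 0 by rewrite pnatr_eq0 -lt0n.
apply: (@circle_integral_derive _ (fun t => (n%:R)^-1 * sin (n%:R * t))).
- by move=> x; apply: continuous_comp; [exact: mulrl_continuous|exact: continuous_cos].
- move=> x; have := is_derive_scale (is_derive_sin (n%:R * x)) => h.
  by apply: is_derive_eq; rewrite /GRing.scale /= mulKf.
- have := periodicn (@sinD2pi R) n 0.
  by rewrite add0r !mulr0 sin0 mulr0 -[_ *+ n]mulr_natl -(mulr_natl pi) => ->; rewrite mulr0.
Qed.

Lemma mean_sin n : (0 < n)%N -> mean (fun t : R => sin (n%:R * t)) = 0.
Proof.
move=> n0; have n1 : (n%:R : R) != 0 by rewrite pnatr_eq0 -lt0n.
apply: (@circle_integral_derive _ (fun t => - (n%:R)^-1 * cos (n%:R * t))).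
- by move=> x; apply: continuous_comp; [exact: mulrl_continuous|exact: continuous_sin].
- move=> x; have := is_derive_scale (is_derive_cos (n%:R * x)) => h.
  by apply: is_derive_eq; rewrite /GRing.scale /= !mulrN mulNr opprK mulKf.
- have := periodicn (@cosD2pi R) n 0.
  by rewrite add0r !mulr0 cos0 -[_ *+ n]mulr_natl -(mulr_natl pi) => ->.
Qed.

Definition cbm (u : R -> C) :=
  bounded_measurable (fun t => Re (u t)) /\ bounded_measurable (fun t => Im (u t)).

Lemma cbm_cst k : cbm (fun=> k). Proof. by split; exact: bm_cst. Qed.

Lemma cbmD u v : cbm u -> cbm v -> cbm (fun t => u t + v t).
Proof.
move=> [a b] [c d]; split; first by under eq_fun do rewrite Re_add; exact: bmD.
by under eq_fun do rewrite Im_add; exact: bmD.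
Qed.

Lemma cbmM u v : cbm u -> cbm v -> cbm (fun t => u t * v t).
Proof.
move=> [a b] [c d]; split; last by under eq_fun do rewrite Im_mul; apply: bmD; exact: bmM.
by under eq_fun do rewrite Re_mul; apply: bmD; [|apply: bmN]; exact: bmM.
Qed.

Lemma cbmX u n : cbm u -> cbm (fun t => u t ^+ n).
Proof.
move=> h; elim: n => [|n IH]; first by under eq_fun do rewrite expr0; exact: cbm_cst.
by under eq_fun do rewrite exprS; exact: cbmM.
Qed.

Lemma cbm_conj u : cbm u -> cbm (fun t => ((u t)^*)%C).
Proof.
move=> [a b]; have hR z : Re (z^*)%C = Re z :> R by case: z.
have hI z : Im (z^*)%C = - Im z :> R by case: z.
by split; [under eq_fun do rewrite hR|under eq_fun do rewrite hI; exact: bmN].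
Qed.

Lemma cbm_sum (u : nat -> R -> C) N : (forall n, cbm (u n)) ->
  cbm (fun t => \sum_(0 <= n < N) u n t).
Proof.
move=> h; split.
  by under eq_fun do rewrite Re_sum; apply: bm_sum => n; case: (h n).
by under eq_fun do rewrite Im_sum; apply: bm_sum => n; case: (h n).
Qed.

Lemma cbm_expi : cbm (@expi R).
Proof.
split => /=; apply: (@bmP _ _ 1).
- exact: continuous_measurable_fun (@continuous_cos R).
- by move=> t; apply/ler_normlP; rewrite lerNl; have := cos_geN1 t; have := cos_le1 t.
- exact: continuous_measurable_fun (@continuous_sin R).
- by move=> t; apply/ler_normlP; rewrite lerNl; have := sin_geN1 t; have := sin_le1 t.
Qed.

Lemma cbm_sqr u : cbm u -> bounded_measurable (fun t => cmod (u t) ^+ 2).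
Proof.
move=> [a b]; under eq_fun do rewrite cmod_sqr !expr2.
by apply: bmD; exact: bmM.
Qed.

Lemma cbm_cmod u : cbm u -> bounded_measurable (fun t => cmod (u t)).
Proof.
move=> [a b]; have [m [M hM]] := cbm_sqr (conj a b).
apply: (@bmP _ _ (M + 1)).
  rewrite (_ : (fun t => cmod (u t)) = Num.sqrt \o (fun t => cmod (u t) ^+ 2)).
    by apply: measurableT_comp => //; apply: continuous_measurable_fun; exact: sqrt_continuous.
  by apply/funext => t /=; rewrite sqrtr_sqr ger0_norm ?cmod_ge0.
move=> t; have := hM t; rewrite !ger0_norm ?exprn_ge0 ?cmod_ge0// => h.
by have := sqr_ge0 (cmod (u t) - 1); nra.
Qed.

Lemma cbm_bound u (M : R) : measurable_fun setT (fun t => Re (u t)) ->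
  measurable_fun setT (fun t => Im (u t)) -> (forall t, cmod (u t) <= M) -> cbm u.
Proof.
move=> a b h; split; apply: (@bmP _ _ M) => // t; apply: le_trans (h t).
  exact: Re_le_cmod.
exact: Im_le_cmod.
Qed.

Lemma cbm_trig (k n : nat) (d : C) :
  cbm (fun t => d * (expi t ^+ k * ((expi t)^*)%C ^+ n)).
Proof.
apply: cbmM; first exact: cbm_cst.
by apply: cbmM; apply: cbmX; [|apply: cbm_conj]; exact: cbm_expi.
Qed.

(** Powers of the conjugate play the role of negative frequencies, so exponents stay natural; after
    cancelling the common power, any nonzero frequency has mean zero. *)
Lemma mean_trig (k n : nat) (d : C) :
  mean (fun t => Re (d * (expi t ^+ k * ((expi t)^*)%C ^+ n))) = (k == n)%:R * Re d.
Proof.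
have bc m : bounded_measurable (fun t : R => cos (m%:R * t)).
  by have := (cbmX m cbm_expi).1; under eq_fun do rewrite expiX.
have bs m : bounded_measurable (fun t : R => sin (m%:R * t)).
  by have := (cbmX m cbm_expi).2; under eq_fun do rewrite expiX.
have cancel a b t : expi t ^+ (a + b) * ((expi t)^*)%C ^+ b = expi t ^+ a :> C.
  by rewrite exprD -mulrA -exprMn expi_conj expr1n mulr1.
have cancel2 a b t : expi t ^+ a * ((expi t)^*)%C ^+ (a + b) = ((expi t)^*)%C ^+ b :> C.
  by rewrite exprD mulrA -exprMn expi_conj expr1n mul1r.
have [kn|nk|->] := ltngtP k n.
- rewrite mul0r -(subnKC (ltnW kn)); under eq_fun => t do
    rewrite cancel2 -rmorphXn /= expiX Re_mul /= mulrN opprK.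
  rewrite meanD; [|exact/bm_integrable/bmZ|exact/bm_integrable/bmZ].
  rewrite !meanZ; [|exact/bm_integrable|exact/bm_integrable].
  by rewrite mean_cos ?subn_gt0// mean_sin ?subn_gt0// !mulr0 addr0.
- rewrite mul0r -(subnK (ltnW nk)); under eq_fun => t do
    rewrite cancel expiX Re_mul /= -mulNr.
  rewrite meanD; [|exact/bm_integrable/bmZ|exact/bm_integrable/bmZ].
  rewrite !meanZ; [|exact/bm_integrable|exact/bm_integrable].
  by rewrite mean_cos ?subn_gt0// mean_sin ?subn_gt0// !mulr0 addr0.
- under eq_fun do rewrite -exprMn expi_conj expr1n mulr1.
  by rewrite mean_cst mul1r.
Qed.

Lemma parseval_poly (a : nat -> C) N :
  mean (fun t => cmod (\sum_(0 <= n < N) a n * expi t ^+ n) ^+ 2) =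
  \sum_(0 <= n < N) cmod (a n) ^+ 2.
Proof.
have E t : cmod (\sum_(0 <= n < N) a n * expi t ^+ n) ^+ 2 =
    \sum_(0 <= n < N) \sum_(0 <= m < N)
      Re (a n * ((a m)^*)%C * (expi t ^+ n * ((expi t)^*)%C ^+ m)).
  transitivity (Re (\sum_(0 <= n < N) \sum_(0 <= m < N)
      (a n * ((a m)^*)%C * (expi t ^+ n * ((expi t)^*)%C ^+ m)))); last first.
    by rewrite Re_sum; apply: eq_bigr => n _; rewrite Re_sum.
  have := mulc_conj (\sum_(0 <= n < N) a n * expi t ^+ n).
  move=> /(congr1 (@complex.Re R)) /= <-; congr complex.Re.
  rewrite mulr_suml; apply: eq_bigr => n _.
  rewrite rmorph_sum mulr_sumr; apply: eq_bigr => m _.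
  by rewrite rmorphM rmorphXn /= mulrACA.
rewrite (eq_mean E).
have bmt n m : circle_integrable (fun t =>
    Re (a n * ((a m)^*)%C * (expi t ^+ n * ((expi t)^*)%C ^+ m))).
  by apply: bm_integrable; have := (cbm_trig n m (a n * ((a m)^*)%C)).1.
rewrite mean_sum; last by move=> n; exact: ci_sum.
rewrite !big_nat; apply: eq_bigr => n /andP[_ nN].
rewrite mean_sum//; under eq_bigr do rewrite mean_trig.
rewrite (bigD1_seq n) ?mem_index_iota ?iota_uniq//= eqxx mul1r big1 ?addr0.
  by rewrite mulc_conj.
by move=> m mn; rewrite eq_sym (negbTE mn) mul0r.
Qed.

Lemma measurable_ccvg (u : nat -> R -> C) g : (forall n, cbm (u n)) ->
  (forall t, cmod (u n t - g t) @[n --> \oo] --> (0 : R)) ->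
  measurable_fun setT (fun t => Re (g t)) /\ measurable_fun setT (fun t => Im (g t)).
Proof.
move=> hu hc; split.
  apply: (@measurable_fun_cvg _ _ _ _ (fun n t => Re (u n t))).
    by move=> n; case: (hu n) => -[].
  by move=> t _; have /ccvgP [] := hc t.
apply: (@measurable_fun_cvg _ _ _ _ (fun n t => Im (u n t))).
  by move=> n; case: (hu n) => _ [].
by move=> t _; have /ccvgP [] := hc t.
Qed.

Lemma cbm_trig_poly (a : nat -> C) N : cbm (fun t => \sum_(0 <= n < N) a n * expi t ^+ n).
Proof.
apply: cbm_sum => n; apply: cbmM; [exact: cbm_cst|exact: cbmX cbm_expi].
Qed.

Lemma cmod_trig_poly (a : nat -> C) N (t : R) :
  cmod (\sum_(0 <= n < N) a n * expi t ^+ n) <= \sum_(0 <= n < N) cmod (a n).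
Proof.
apply: le_trans (cmod_le_sum _ _ _) _; apply: ler_sum => n _.
by rewrite cmodM cmodX cmod_expi expr1n mulr1.
Qed.

Lemma cmod_trig_series (a : nat -> C) (g : R -> C) M :
  (forall N, \sum_(0 <= n < N) cmod (a n) <= M) ->
  (forall t, cmod (\sum_(0 <= n < N) a n * expi t ^+ n - g t) @[N --> \oo] --> (0 : R)) ->
  forall t, cmod (g t) <= M.
Proof.
move=> hM hg t; apply: (cvgr_to_le (cvg_cmod (hg t))); near=> N.
exact: le_trans (cmod_trig_poly _ _ _) (hM N).
Unshelve. all: by end_near. Qed.

Lemma cbm_trig_series (a : nat -> C) (g : R -> C) M :
  (forall N, \sum_(0 <= n < N) cmod (a n) <= M) ->
  (forall t, cmod (\sum_(0 <= n < N) a n * expi t ^+ n - g t) @[N --> \oo] --> (0 : R)) ->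
  cbm g.
Proof.
move=> hM hg; have [mR mI] := measurable_ccvg (cbm_trig_poly a) hg.
exact: cbm_bound mR mI (cmod_trig_series hM hg).
Qed.

(** Absolute summability gives a constant dominating function, so the identity for polynomials
    passes to the limit. *)
Lemma parseval (a : nat -> C) (g : R -> C) M :
  (forall N, \sum_(0 <= n < N) cmod (a n) <= M) ->
  (forall t, cmod (\sum_(0 <= n < N) a n * expi t ^+ n - g t) @[N --> \oo] --> (0 : R)) ->
  \sum_(0 <= n < N) cmod (a n) ^+ 2 @[N --> \oo] --> mean (fun t => cmod (g t) ^+ 2).
Proof.
move=> hM hg; under eq_fun do rewrite -parseval_poly.
apply: (@mean_bounded_cvg _ _ _ (M ^+ 2)).
- by move=> n; have [] := cbm_sqr (cbm_trig_poly a n).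
- by have [] := cbm_sqr (cbm_trig_series hM hg).
- move=> n t; rewrite ger0_norm ?exprn_ge0 ?cmod_ge0//.
  have h := le_trans (cmod_trig_poly a n t) (hM n).
  by rewrite ler_pXn2r// nnegrE ?cmod_ge0// (le_trans (cmod_ge0 _) h).
- apply: aeW => t _; under eq_fun do rewrite expr2; rewrite expr2.
  by apply: cvgM; exact: cvg_cmod.
Qed.

End Trigonometric.

(** * The Poisson kernel and outer functions *)

Section Poisson.
Variable R : realType.
Local Notation C := R[i].
Local Notation mu := (@lebesgue_measure R).
Implicit Types (z : C) (f : C -> C).

(** The denominator equals |e^(is) - z|^2; in this form the kernel is Re ((1 + q) / (1 - q)), where
    q is z times the conjugate of e^(is). *)
Definition poisson z (s : R) : R :=
  (1 - cmod z ^+ 2) / cmod (1 - z * ((expi s)^*)%C) ^+ 2.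

Lemma cmod_rot z (s : R) : cmod (z * ((expi s)^*)%C) = cmod z.
Proof. by rewrite cmodM cmod_conj cmod_expi mulr1. Qed.

Lemma cmod_1sub z : 1 - cmod z <= cmod (1 - z).
Proof. by have := cmod_dist 1 z; rewrite cmod1; apply: le_trans; exact: ler_norm. Qed.

Lemma poisson_ge0 z s : cmod z < 1 -> 0 <= poisson z s.
Proof. by move=> /cmod_ltP z1; rewrite divr_ge0 ?exprn_ge0 ?cmod_ge0// ltW. Qed.

(** Summing the geometric series in (1 + q) / (1 - q) up to N leaves exactly 2 q^N / (1 - q), where
    |q| = |z|. *)
Lemma poisson_approx z s N : cmod z < 1 ->
  `|poisson z s - (2 * Re (\sum_(0 <= n < N) z ^+ n * ((expi s)^*)%C ^+ n) - 1)| <=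
  2 * cmod z ^+ N / (1 - cmod z).
Proof.
move=> z1; set q := z * ((expi s)^*)%C.
have qz : cmod q = cmod z by exact: cmod_rot.
have d0 : 0 < 1 - cmod z by rewrite subr_gt0.
have q1 : 1 - q != 0.
  rewrite -cmod_eq0 gt_eqF//; apply: lt_le_trans (cmod_1sub q); by rewrite qz.
under eq_bigr do rewrite -exprMn -/q.
have S : \sum_(0 <= n < N) q ^+ n = (1 - q ^+ N) / (1 - q).
  apply: (mulIf q1); rewrite divfK//.
  elim: N => [|N IH]; first by rewrite big_geq// mul0r expr0 subrr.
  by rewrite big_nat_recr//= mulrDl IH exprS; ring.
have P : poisson z s = Re ((1 + q) / (1 - q)).
  rewrite /poisson -/q -qz.
  have -> : (1 + q) / (1 - q) = (1 + q) * ((1 - q)^*)%C * (((cmod (1 - q) ^+ 2)^-1)%:C)%C.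
    rewrite fmorphV /= -mulc_conj.
    have : ((1 - q)^*)%C != 0 by rewrite conjc_eq0.
    by move: ((1 - q)^*)%C => w w0; rewrite -mulf_div divff// mulr1.
  rewrite Re_mul /= mulr0 subr0; congr (_ / _).
  by rewrite cmod_sqr; case: (q) => a b /=; ring.
have -> : poisson z s - (2 * Re (\sum_(0 <= n < N) q ^+ n) - 1) =
    Re (2 * (q ^+ N / (1 - q))).
  have -> : 2 * (q ^+ N / (1 - q)) = (1 + q) / (1 - q) - (2 * ((1 - q ^+ N) / (1 - q)) - 1).
    by field.
  rewrite -S P.
  by move: ((1 + q) / (1 - q)) (\sum_(0 <= n < N) q ^+ n) => [a b] [x y] /=; ring.
apply: le_trans (Re_le_cmod _) _.
rewrite cmodM cmodM cmodV cmodX qz -mulrA.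
have -> : cmod (2 : C) = 2.
  have -> : (2 : C) = ((2 : R)%:C)%C by rewrite rmorph_nat.
  by rewrite cmod_real ger0_norm.
rewrite ler_wpM2l// ler_wpM2l ?exprn_ge0 ?cmod_ge0//.
rewrite lef_pV2 ?posrE//; last by rewrite lt_neqAle eq_sym cmod_eq0 q1 cmod_ge0.
by have := cmod_1sub q; rewrite qz.
Qed.

Lemma bm_poisson z : cmod z < 1 -> bounded_measurable (poisson z).
Proof.
move=> z1; have d0 : 0 < 1 - cmod z by rewrite subr_gt0.
pose D N s := 2 * Re (\sum_(0 <= n < N) z ^+ n * ((expi s)^*)%C ^+ n) - 1 : R.
have bD N : bounded_measurable (D N).
  apply: bmD; last exact: bm_cst.
  apply: bmZ; have [] // : cbm (fun s => \sum_(0 <= n < N) z ^+ n * ((expi s)^*)%C ^+ n).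
  apply: cbm_sum => n; apply: cbmM; first exact: cbm_cst.
  by apply: cbmX; apply: cbm_conj; exact: cbm_expi.
apply: (@bmP _ _ (2 / (1 - cmod z) + 1)).
- apply: (@measurable_fun_cvg _ _ _ _ D); first by move=> N; case: (bD N).
  move=> s _; apply/cvgrPdist_le => e e0; near=> N.
  apply: le_trans (poisson_approx s N z1) _.
  rewrite -mulrA mulrCA -(@ler_pdivlMr _ (2 / (1 - cmod z))) ?divr_gt0//.
  near: N.
  have c0 : cmod z ^+ N @[N --> \oo] --> (0 : R).
    by apply: cvg_expr; rewrite ger0_norm// cmod_ge0.
  by apply: (cvgr_le _ c0); rewrite !divr_gt0.
(* For N = 0 the approximating polynomial is the constant -1, which yields an explicit bound on the
   kernel. *)
- move=> s; have := poisson_approx s 0 z1; rewrite big_geq//= mulr0 sub0r opprK expr0 mulr1.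
  by move=> h; have := ler_normB (poisson z s + 1) 1; rewrite addrK normr1; lra.
Unshelve. all: by end_near. Qed.

(** The approximation of the kernel is uniform in s, so integrability of u is enough for the
    limit. *)
Lemma mean_poisson_approx z (u : R -> R) : cmod z < 1 -> circle_integrable u ->
  mean (fun s => (2 * Re (\sum_(0 <= n < N) z ^+ n * ((expi s)^*)%C ^+ n) - 1) * u s)
    @[N --> \oo] --> mean (fun s => poisson z s * u s).
Proof.
move=> z1 hu; have d0 : 0 < 1 - cmod z by rewrite subr_gt0.
pose D N s := 2 * Re (\sum_(0 <= n < N) z ^+ n * ((expi s)^*)%C ^+ n) - 1 : R.
have bD N : bounded_measurable (D N).
  apply: bmD; last exact: bm_cst.
  apply: bmZ; have [] // : cbm (fun s => \sum_(0 <= n < N) z ^+ n * ((expi s)^*)%C ^+ n).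
  apply: cbm_sum => n; apply: cbmM; first exact: cbm_cst.
  by apply: cbmX; apply: cbm_conj; exact: cbm_expi.
have bP := bm_poisson z1.
have key N : `|mean (fun s => poisson z s * u s) - mean (fun s => D N s * u s)| <=
    cmod z ^+ N * (2 / (1 - cmod z) * mean (fun s => `|u s|)).
  rewrite -meanN; last exact: ciM.
  rewrite -meanD; [|exact: ciM|by apply: ciN; exact: ciM].
  have ib : circle_integrable (fun s => poisson z s * u s + - (D N s * u s)).
    by apply: ciD; [|apply: ciN]; exact: ciM.
  apply: le_trans (mean_norm_le ib) _.
  rewrite -meanZ; last exact: ci_norm.
  rewrite -meanZ; last by apply: ciZ; exact: ci_norm.
  apply: mean_le; [exact: ci_norm|by apply: ciZ; apply: ciZ; exact: ci_norm|].
  move=> s _; rewrite -mulrBl normrM mulrA ler_wpM2r//.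
  by apply: le_trans (poisson_approx s N z1) _; rewrite mulrCA mulrA.
apply/cvgrPdist_le => e e0; near=> N.
apply: le_trans (key N) _; near: N.
set K := 2 / _ * _.
have c0 : cmod z ^+ N * K @[N --> \oo] --> (0 : R).
  by rewrite -(mul0r K); apply: cvgMl; apply: cvg_expr; rewrite ger0_norm// cmod_ge0.
exact: (cvgr_le _ c0).
Unshelve. all: by end_near. Qed.

Lemma mean_poisson_trig z k (d : C) : cmod z < 1 ->
  mean (fun s => poisson z s * Re (d * expi s ^+ k)) = Re (d * z ^+ k).
Proof.
move=> z1.
have bu : bounded_measurable (fun s => Re (d * expi s ^+ k)).
  by have [] := cbmM (cbm_cst d) (cbmX k (@cbm_expi R)).
have h := mean_poisson_approx z1 (bm_integrable bu).
apply: (cvg_unique _ h) => //; apply: cvg_near_cst; near=> N.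
have kN : (k < N)%N by near: N; exact: nbhs_infty_gt.
(* This is 2 Re x Re y = Re (x y) + Re (x conj(y)), term by term. In the mean, the first family
   survives only at n = k; the second only at n = k = 0, where it cancels the contribution of the
   -1. *)
have E s : (2 * Re (\sum_(0 <= n < N) z ^+ n * ((expi s)^*)%C ^+ n) - 1)
      * Re (d * expi s ^+ k) =
    (\sum_(0 <= n < N) (Re (d * z ^+ n * (expi s ^+ k * ((expi s)^*)%C ^+ n)) +
       Re ((d^*)%C * z ^+ n * (expi s ^+ 0 * ((expi s)^*)%C ^+ (k + n)))))
    + - Re (d * (expi s ^+ k * ((expi s)^*)%C ^+ 0)).
  rewrite mulrBl mul1r !expr0 mulr1 Re_sum mulr_sumr mulr_suml; congr (_ - _).
  apply: eq_bigr => n _; rewrite mul1r exprD.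
  have -> : ((expi s)^*)%C ^+ k = ((expi s ^+ k)^*)%C by rewrite rmorphXn.
  case: (expi s ^+ k) => a b; case: (((expi s)^*)%C ^+ n) => a' b'.
  by case: (z ^+ n) => x y; case: (d) => d1 d2 /=; ring.
rewrite (eq_mean E).
have i1 n : circle_integrable (fun s => Re (d * z ^+ n * (expi s ^+ k * ((expi s)^*)%C ^+ n))).
  by apply: bm_integrable; have [] := cbm_trig k n (d * z ^+ n).
have i2 n : circle_integrable (fun s =>
    Re ((d^*)%C * z ^+ n * (expi s ^+ 0 * ((expi s)^*)%C ^+ (k + n)))).
  by apply: bm_integrable; have [] := cbm_trig 0 (k + n) ((d^*)%C * z ^+ n).
have i3 : circle_integrable (fun s => Re (d * (expi s ^+ k * ((expi s)^*)%C ^+ 0))).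
  by apply: bm_integrable; have [] := cbm_trig k 0 d.
rewrite meanD; [|by apply: ci_sum => n; exact: ciD|exact: ciN].
rewrite mean_sum; last by move=> n; exact: ciD.
rewrite meanN// mean_trig.
under eq_bigr => n _ do rewrite meanD// !mean_trig.
rewrite big_split /= (bigD1_seq k) ?mem_index_iota ?iota_uniq//= eqxx mul1r big1; last first.
  by move=> n nk; rewrite eq_sym (negbTE nk) mul0r.
rewrite addr0 -addrA; rewrite [X in _ + X = _](_ : _ = 0) ?addr0//.
apply/eqP; rewrite subr_eq0; apply/eqP.
rewrite -(prednK (leq_ltn_trans (leq0n _) kN)) big_nat_recl//= addn0 expr0 mulr1.
rewrite big1 ?addr0; last by move=> n _; rewrite addnS mul0r.
by rewrite [0%N == k]eq_sym; case: (d).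
Unshelve. all: by end_near. Qed.

Lemma poisson_trig_series z (a : nat -> C) (g : R -> C) l M : cmod z < 1 ->
  (forall N, \sum_(0 <= n < N) cmod (a n) <= M) ->
  (forall t, cmod (\sum_(0 <= n < N) a n * expi t ^+ n - g t) @[N --> \oo] --> (0 : R)) ->
  cmod (\sum_(0 <= n < N) a n * z ^+ n - l) @[N --> \oo] --> (0 : R) ->
  mean (fun s => poisson z s * Re (g s)) = Re l.
Proof.
move=> z1 hM hg /ccvgP [hl _].
have [mP [B hB]] := bm_poisson z1.
have [[mg _] _] := cbm_trig_series hM hg.
suff h : Re (\sum_(0 <= n < N) a n * z ^+ n) @[N --> \oo] -->
    mean (fun s => poisson z s * Re (g s)) by exact: (cvg_unique _ h hl).
have E N : mean (fun s => poisson z s * Re (\sum_(0 <= n < N) a n * expi s ^+ n)) =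
    Re (\sum_(0 <= n < N) a n * z ^+ n).
  under eq_fun do rewrite Re_sum mulr_sumr.
  rewrite mean_sum.
    by rewrite Re_sum; apply: eq_bigr => n _; exact: mean_poisson_trig.
  move=> n; apply: bm_integrable; apply: bmM; first exact: bm_poisson.
  by have [] := cbmM (cbm_cst (a n)) (cbmX n (@cbm_expi R)).
under eq_fun do rewrite -E.
apply: (@mean_bounded_cvg _ _ _ (B * M)).
- by move=> n; apply: measurable_funM => //; have [[]] := cbm_trig_poly a n.
- exact: measurable_funM.
- move=> n t; rewrite normrM ler_pM//; apply: le_trans (Re_le_cmod _) _.
  exact: le_trans (cmod_trig_poly _ _ _) (hM n).
- apply: aeW => t _; apply: cvgMr.
  by have /ccvgP [] := hg t.
Qed.

Lemma disk_series_trig f c (r : R) : disk_series f c -> 0 <= r -> r < 1 ->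
  (exists M, forall N, \sum_(0 <= n < N) cmod (c n * (r%:C)%C ^+ n) <= M) /\
  (forall t, cmod (\sum_(0 <= n < N) c n * (r%:C)%C ^+ n * expi t ^+ n -
     f ((r%:C)%C * expi t)) @[N --> \oo] --> (0 : R)).
Proof.
move=> hf r0 r1; split.
  have [M hM] := disk_series_abs_summable hf r0 r1; exists M => N.
  by under eq_bigr do rewrite cmodM cmodX cmod_real ger0_norm//.
move=> t; under eq_fun => N do under eq_bigr => n _ do rewrite -mulrA -exprMn.
by apply: hf; rewrite cmod_circle.
Qed.

Lemma cbm_disk_series f c (r : R) : disk_series f c -> 0 <= r -> r < 1 ->
  cbm (fun t => f ((r%:C)%C * expi t)).
Proof.
by move=> hf r0 r1; have [[M hM] hg] := disk_series_trig hf r0 r1; exact: cbm_trig_series hM hg.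
Qed.

Lemma parseval_disk f c (r : R) : disk_series f c -> 0 <= r -> r < 1 ->
  \sum_(0 <= n < N) cmod (c n) ^+ 2 * r ^+ n ^+ 2 @[N --> \oo] -->
  mean (fun t => cmod (f ((r%:C)%C * expi t)) ^+ 2).
Proof.
move=> hf r0 r1; have [[M hM] hg] := disk_series_trig hf r0 r1.
have := parseval hM hg.
by under eq_fun => N do under eq_bigr => n _ do
  rewrite cmodM cmodX cmod_real ger0_norm// exprMn.
Qed.

Lemma bessel_disk f c (r : R) N : disk_series f c -> 0 <= r -> r < 1 ->
  \sum_(0 <= n < N) cmod (c n) ^+ 2 * r ^+ n ^+ 2 <=
  mean (fun t => cmod (f ((r%:C)%C * expi t)) ^+ 2).
Proof.
move=> hf r0 r1; have h := parseval_disk hf r0 r1.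
have nd : {homo (fun N => \sum_(0 <= n < N) cmod (c n) ^+ 2 * r ^+ n ^+ 2) :
    n m / (n <= m)%N >-> n <= m}.
  apply/nondecreasing_seqP => n; rewrite big_nat_recr//= lerDl.
  by rewrite mulr_ge0// ?exprn_ge0 ?cmod_ge0.
have cv : cvgn (fun N => \sum_(0 <= n < N) cmod (c n) ^+ 2 * r ^+ n ^+ 2).
  by apply/cvg_ex; eexists; exact: h.
by have := nondecreasing_cvgn_le nd cv N; rewrite (cvg_lim _ h).
Qed.

Lemma poisson_disk_series f c (r : R) z : disk_series f c -> 0 <= r -> r < 1 ->
  cmod z < 1 ->
  mean (fun s => poisson z s * Re (f ((r%:C)%C * expi s))) = Re (f ((r%:C)%C * z)).
Proof.
move=> hf r0 r1 z1; have [[M hM] hg] := disk_series_trig hf r0 r1.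
exact: (poisson_trig_series z1 hM hg (disk_series_scale r0 (ltW r1) hf z1)).
Qed.

Lemma mean_poisson z : cmod z < 1 -> mean (poisson z) = 1.
Proof.
move=> z1; transitivity (mean (fun s => poisson z s * Re (1 * expi s ^+ 0))).
  by apply: eq_mean => s; rewrite expr0 mulr1 /= mulr1.
by rewrite mean_poisson_trig// expr0 mulr1.
Qed.

(** The Fourier coefficients of u are bounded by its L1 mean, hence define an analytic F on the
    disk; halving the constant one makes 2 Re F the Poisson integral of u, and W = exp F. At the
    centre the kernel is 1, which gives the constant coefficient. *)
Lemma outer_function (u : R -> R) : circle_integrable u ->
  exists W e, [/\ disk_series W e,
    forall z, cmod z < 1 -> cmod (W z) ^+ 2 = expR (mean (fun s => poisson z s * u s)) &
    cmod (e 0%N) ^+ 2 = expR (mean u)].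
Proof.
move=> hu.
pose E n s : C := ((expi s)^*)%C ^+ n.
have bE n : cbm (E n) by apply: cbmX; apply: cbm_conj; exact: cbm_expi.
(* Coefficients of half the Herglotz integral: the subtraction at n = 0 leaves half the mean of u,
   while the higher coefficients appear in full. *)
pose a n : C := ((mean (fun s => Re (E n s) * u s) - (n == 0%N)%:R * (2^-1 * mean u)) +i*
                 mean (fun s => Im (E n s) * u s))%C.
have cE n s : cmod (E n s) <= 1 by rewrite cmodX cmod_conj cmod_expi expr1n.
pose B := mean (fun s => `|u s|).
have bnd (v : R -> R) : bounded_measurable v -> (forall s, `|v s| <= 1) ->
    `|mean (fun s => v s * u s)| <= B.
  move=> bv v1; apply: le_trans (mean_norm_le (ciM hu bv)) _.
  apply: mean_le; [exact/ci_norm/ciM|exact: ci_norm|].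
  by move=> s _; rewrite normrM ler_piMl.
have B0 : 0 <= B by apply: mean_ge0 => s _.
have aB n : cmod (a n) <= 3 * B.
  apply: le_trans (cmod_le_ReIm _) _; rewrite /a /=.
  have h1 : `|mean (fun s => Re (E n s) * u s)| <= B.
    by apply: bnd; [case: (bE n)|move=> s; exact: le_trans (Re_le_cmod _) (cE n s)].
  have h2 : `|mean (fun s => Im (E n s) * u s)| <= B.
    by apply: bnd; [case: (bE n)|move=> s; exact: le_trans (Im_le_cmod _) (cE n s)].
  have h3 : `|(n == 0%N)%:R * (2^-1 * mean u)| <= B.
    have := mean_norm_le hu; rewrite -/B => h.
    have B2 : `|2^-1 * mean u| <= B.
      by rewrite normrM ger0_norm ?invr_ge0//; lra.
    by case: (n == 0%N); rewrite ?mul1r ?mul0r ?normr0.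
  have := ler_normB (mean (fun s => Re (E n s) * u s)) ((n == 0%N)%:R * (2^-1 * mean u)).
  by move=> h4; lra.
have [F hF] : exists F, disk_series F a.
  apply: abs_summable_disk_series => s s0 s1; exists (3 * B * (1 - s)^-1) => N.
  apply: le_trans (ler_wpM2l _ (sum_geometric_le N s0 s1)); last by rewrite mulr_ge0.
  by rewrite mulr_sumr; apply: ler_sum => n _; rewrite ler_wpM2r ?exprn_ge0.
have key z : cmod z < 1 -> 2 * Re (F z) = mean (fun s => poisson z s * u s).
  move=> z1; have h := mean_poisson_approx z1 hu.
  have /ccvgP [hR _] := hF _ z1.
  have {}hR : 2 * Re (\sum_(0 <= n < N) a n * z ^+ n) @[N --> \oo] --> 2 * Re (F z).
    by apply: cvgMr.
  apply: (cvg_unique _ hR) => //; apply: cvg_trans h; apply: near_eq_cvg; near=> N.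
  have N0 : (0 < N)%N by near: N; exact: nbhs_infty_gt.
  have bT n : bounded_measurable (fun s => Re (z ^+ n * E n s)).
    by have [] := cbmM (cbm_cst (z ^+ n)) (bE n).
  have T n : Re (a n * z ^+ n) = mean (fun s => Re (z ^+ n * E n s) * u s) -
      (n == 0%N)%:R * (2^-1 * mean u).
    have -> : mean (fun s => Re (z ^+ n * E n s) * u s) =
       Re (z ^+ n) * mean (fun s => Re (E n s) * u s) -
       Im (z ^+ n) * mean (fun s => Im (E n s) * u s).
      have [bR bI] := bE n.
      rewrite -!meanZ; [|exact: ciM|exact: ciM].
      rewrite -meanN; last by apply: ciZ; exact: ciM.
      rewrite -meanD; [|by apply: ciZ; exact: ciM|by apply: ciN; apply: ciZ; exact: ciM].
      by apply: eq_mean => s; rewrite Re_mul; ring.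
    rewrite Re_mul /a /=; case: n => [|n] /=; last by rewrite !mul0r !subr0; ring.
    by rewrite ?expr0 /=; ring.
  under eq_fun do rewrite mulrBl mul1r Re_sum -mulrA mulr_suml.
  rewrite meanD; [|by apply: ciZ; apply: ci_sum => n; exact: ciM|exact: ciN].
  rewrite meanZ; last by apply: ci_sum => n; exact: ciM.
  rewrite mean_sum; last by move=> n; exact: ciM.
  rewrite meanN// Re_sum; under [in RHS]eq_bigr do rewrite T.
  rewrite big_split /= mulrDr; congr (_ + _).
  rewrite -(prednK N0) big_nat_recl//= big1 ?addr0; last first.
    by move=> i _; rewrite mul0r oppr0.
  by rewrite mul1r mulrN mulrA mulfV ?mul1r// pnatr_eq0.
have [e he] := disk_series_cexp hF.
exists (fun z => cexp (F z)), e; split => //.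
  by move=> z z1; rewrite cmod_cexp key.
rewrite (disk_series0 he) cmod_cexp key ?cmod0//; congr expR; apply: eq_mean => s.
by rewrite /poisson mul0r subr0 cmod1 cmod0 expr0n /= subr0 expr1n divr1 mul1r.
Unshelve. all: by end_near. Qed.

End Poisson.

(** * Radial limits of Poisson integrals at Lebesgue points *)

Section PoissonLimit.
Variable R : realType.
Local Notation C := R[i].
Local Notation mu := (@lebesgue_measure R).

Lemma le_cos (x y : R) : 0 <= x -> x <= y -> y <= pi -> cos y <= cos x.
Proof.
move=> x0 xy yp; rewrite leNgt ltr_cos ?in_itv /= ?x0 ?yp ?(le_trans x0 xy) ?(le_trans xy yp)//.
by rewrite -leNgt.
Qed.

Lemma sin_ge (y : R) : 0 <= y -> y <= 1 -> cos 1 * y <= sin y.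
Proof.
move=> y0 y1; have [c] := @MVT_segment R sin cos 0 y y0
  (fun x _ => is_derive_sin x) (continuous_subspaceT (@continuous_sin R)).
rewrite in_itv /= sin0 !subr0 => /andP[c0 cy] ->; rewrite ler_wpM2r//.
by apply: le_cos => //; [exact: le_trans cy y1|have := pi_ge2 R; lra].
Qed.

(** From 1 - cos y = 2 sin^2 (y/2) and the slope bound cos 1 for the sine on [0, 1]. *)
Definition cos_gap : R := cos 1 ^+ 2 / 2.

Lemma cos_gap_gt0 : 0 < cos_gap.
Proof. by rewrite divr_gt0// exprn_gt0// cos1_gt0. Qed.

Lemma one_sub_cos_ge (x : R) : `|x| <= 1 -> cos_gap * x ^+ 2 <= 1 - cos x.
Proof.
move=> x1; rewrite -cos_norm -(real_normK (num_real x)).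
move: `|x| (normr_ge0 x) x1 => y y0 y1.
have hs : cos 1 * (y / 2) <= sin (y / 2) by apply: sin_ge; lra.
have -> : cos y = 1 - 2 * sin (y / 2) ^+ 2.
  have {1}-> : y = (y / 2) *+ 2 by rewrite -[RHS]mulr_natr divfK.
  by rewrite cos_mulr2n cos2sin2 -[_ *+ 2]mulr_natl; ring.
have h0 : 0 <= cos 1 * (y / 2) by apply: mulr_ge0; [exact/ltW/cos1_gt0|lra].
have h2 : (cos 1 * (y / 2)) ^+ 2 <= sin (y / 2) ^+ 2.
  by rewrite ler_pXn2r ?nnegrE// (le_trans h0 hs).
have -> : cos_gap * y ^+ 2 = 2 * (cos 1 * (y / 2)) ^+ 2 by rewrite /cos_gap; field.
by lra.
Qed.

Lemma cos_far (h x : R) : 0 <= h -> h <= x -> x <= 2 * pi - h -> cos x <= cos h.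
Proof.
move=> h0 hx xh; have [xp|px] := leP x pi; first exact: le_cos.
have -> : cos x = cos (2 * pi - x).
  by rewrite -[RHS]cosN opprB -[RHS]cosD2pi mulr_natl subrK.
by apply: le_cos; lra.
Qed.

Lemma poisson_polar (r t s : R) : 0 <= r ->
  poisson ((r%:C)%C * expi t) s =
  (1 - r ^+ 2) / ((1 - r) ^+ 2 + 2 * r * (1 - cos (t - s))).
Proof.
move=> r0; rewrite /poisson cmod_circle//; congr (_ / _).
rewrite cmod_sqr /expi cosB /=.
have ct := cos2Dsin2 t; have cs := cos2Dsin2 s.
move: (cos t) (sin t) (cos s) (sin s) ct cs => a b c d ct cs.
transitivity (1 - 2 * r * (a * c + b * d) + r ^+ 2 * (a ^+ 2 + b ^+ 2) * (c ^+ 2 + d ^+ 2)).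
  by ring.
by rewrite ct cs; ring.
Qed.

(** The upper bound on |t - s| keeps s away from t modulo 2 pi as well. The factor 1 - r comes from
    1 - r^2, and r >= 1/2 gives 1 + r <= 4 r. *)
Lemma poisson_far (r t s h : R) : 1 / 2 <= r -> r < 1 -> 0 < h -> h <= pi ->
  h <= `|t - s| -> `|t - s| <= 2 * pi - h ->
  poisson ((r%:C)%C * expi t) s <= (1 - r) * (2 / (1 - cos h)).
Proof.
move=> r2 r1 h0 hp hts tsh; rewrite poisson_polar; last lra.
have ch : cos (t - s) <= cos h by rewrite -cos_norm; apply: cos_far => //; exact: ltW.
have c1 : cos h < 1.
  by rewrite -[X in _ < X](@cos0 R) ltr_cos ?in_itv /= ?lexx ?pi_ge0 ?(ltW h0) ?hp.
have d0 : 0 < 1 - cos h by lra.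
have D0 : 0 <= (1 - r) ^+ 2 by exact: sqr_ge0.
have E0 : (1 + r) * (1 - cos h) <= 4 * r * (1 - cos (t - s)) by nra.
rewrite mulrA ler_pdivlMr// mulrAC ler_pdivrMr; last by nra.
have -> : (1 - r ^+ 2) * (1 - cos h) = (1 - r) * ((1 + r) * (1 - cos h)) by ring.
rewrite -[leRHS]mulrA ler_wpM2l//; first lra.
by lra.
Qed.

(** Uses 1 + r <= 2 in the numerator, and 2 r >= 1 with the quadratic bound for the cosine in the
    denominator. *)
Lemma poisson_near (r t s : R) : 1 / 2 <= r -> r < 1 -> `|t - s| <= 1 ->
  poisson ((r%:C)%C * expi t) s <=
  2 * (1 - r) / ((1 - r) ^+ 2 + cos_gap * (t - s) ^+ 2).
Proof.
move=> r2 r1 ts1; rewrite poisson_polar; last lra.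
have g0 := cos_gap_gt0; have h := one_sub_cos_ge ts1.
have s0 := sqr_ge0 (t - s).
have d0 : 0 < (1 - r) ^+ 2 by rewrite exprn_gt0// subr_gt0.
have e0 : 0 <= cos_gap * (t - s) ^+ 2 by rewrite mulr_ge0// ltW.
rewrite ler_pdivrMr; last by nra.
rewrite mulrAC ler_pdivlMr; last lra.
move: ((1 - r) ^+ 2) (cos_gap * (t - s) ^+ 2) (cos (t - s)) d0 e0 h => D E K d0 e0 h.
have -> : (1 - r ^+ 2) * (D + E) = (1 - r) * ((1 + r) * (D + E)) by ring.
have -> : 2 * (1 - r) * (D + 2 * r * (1 - K)) = (1 - r) * (2 * (D + 2 * r * (1 - K))) by ring.
rewrite ler_wpM2l//; first lra.
by nra.
Qed.

(** The 2 serves the inner ball |x| < d, and 8 / [cos_gap] the shells around it. *)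
Definition dyadic_const : R := Num.max 2 (8 / cos_gap).

(* On the dyadic shell [2^(j-1) d <= |x| < 2^j d] the kernel is at most [c/d * 4^-j]. *)
Lemma dyadic_bound (d x : R) (J : nat) : 0 < d -> `|x| < 2 ^+ J * d ->
  2 * d / (d ^+ 2 + cos_gap * x ^+ 2) <=
  \sum_(0 <= j < J.+1) dyadic_const / d * 4^-1 ^+ j * \1_(ball (0 : R) (2 ^+ j * d)) x.
Proof.
move=> d0 xJ; have g0 := cos_gap_gt0.
have c0 : 0 < dyadic_const by rewrite lt_max ltr0n.
have exj : exists j, `|x| < 2 ^+ j * d by exists J.
(* The least j with |x| < 2^j d selects one term, which alone dominates the kernel; minimality gives
   |x| >= 2^(j-1) d when j > 0. *)
case: (ex_minnP exj) => j xj minj.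
have jJ : (j <= J)%N by exact: minj.
have T i : 0 <= dyadic_const / d * 4^-1 ^+ i * \1_(ball (0 : R) (2 ^+ i * d)) x.
  apply: mulr_ge0 => //; apply: mulr_ge0; first exact/ltW/divr_gt0.
  by rewrite exprn_ge0// invr_ge0.
have xb : \1_(ball (0 : R) (2 ^+ j * d)) x = 1 :> R.
  by rewrite indicE mem_set// /ball /= sub0r normrN.
rewrite (bigD1_seq j) ?mem_index_iota ?iota_uniq//= xb mulr1.
apply: ler_wpDr; first by apply: sumr_ge0 => i _; exact: T.
have x20 := sqr_ge0 x.
have D0 : 0 < d ^+ 2 + cos_gap * x ^+ 2.
  by apply: ltr_pwDl; [exact: exprn_gt0|rewrite mulr_ge0// ltW].
case: j xj minj {jJ xb} => [|j] xj minj.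
  rewrite expr0 mulr1 ler_pdivrMr// mulrAC ler_pdivlMr//.
  have h2 : 2 <= dyadic_const by rewrite le_max lexx.
  have : 2 * (d ^+ 2 + cos_gap * x ^+ 2) <= dyadic_const * (d ^+ 2 + cos_gap * x ^+ 2).
    by rewrite ler_wpM2r// ltW.
  have : 0 <= cos_gap * x ^+ 2 by rewrite mulr_ge0// ltW.
  by rewrite expr2; nra.
have xj' : 2 ^+ j * d <= `|x|.
  by rewrite leNgt; apply/negP => /minj; rewrite ltnn.
have x2 : 4 ^+ j * d ^+ 2 <= x ^+ 2.
  have -> : (4 : R) ^+ j = (2 ^+ j) ^+ 2 by rewrite exprAC; congr (_ ^+ _); ring.
  rewrite -exprMn -(real_normK (num_real x)) ler_pXn2r ?nnegrE//.
  by rewrite mulr_ge0 ?exprn_ge0// ltW.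
have h8 : 8 <= dyadic_const * cos_gap.
  by rewrite -ler_pdivrMr// le_max lexx orbT.
have p4 : 0 < (4 : R) ^+ j by rewrite exprn_gt0.
rewrite ler_pdivrMr//.
have k0 : 0 < dyadic_const / d * 4^-1 ^+ j.+1.
  by rewrite mulr_gt0 ?divr_gt0// exprn_gt0// invr_gt0.
apply: (@le_trans _ _ (dyadic_const / d * 4^-1 ^+ j.+1 * (cos_gap * (4 ^+ j * d ^+ 2)))).
  have -> : dyadic_const / d * 4^-1 ^+ j.+1 * (cos_gap * (4 ^+ j * d ^+ 2)) =
      (dyadic_const * cos_gap) / 4 * d.
    by rewrite exprVn exprS; field; rewrite !gt_eqF.
  by rewrite ler_pM2r//; lra.
rewrite ler_pM2l//; apply: (@le_trans _ _ (cos_gap * x ^+ 2)).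
  by rewrite ler_pM2l.
by rewrite lerDr exprn_ge0// ltW.
Qed.

Lemma bm_locally_integrable (f : R -> R) : bounded_measurable f -> locally_integrable setT f.
Proof.
move=> [mf [M hM]]; split => //; first exact: openT.
move=> K _ cK.
have mK : measurable K by apply: closed_measurable; exact: compact_closed.
have iK : mu.-integrable K (EFin \o f).
  apply: measurable_bounded_integrable => //.
  - exact: compact_finite_measure.
  - exact: measurable_funTS.
  - exists M; split; first exact: num_real.
    by move=> x Mx t _ /=; apply: le_trans (hM t) (ltW Mx).
by have /integrableP [_] := iK.
Qed.

Lemma bm_indic_ball (t h : R) : bounded_measurable (\1_(ball t h) : R -> R).
Proof.
apply: (@bmP _ _ 1); first by apply: measurable_indic; exact: measurable_ball.
by move=> s; rewrite indicE; case: (_ \in _) => /=; rewrite ?normr1 ?normr0.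
Qed.

Lemma bm_dist (f : R -> R) a : bounded_measurable f -> bounded_measurable (fun s => `|f s - a|).
Proof.
move=> bf; have [mg [M hM]] := bmD bf (bm_cst (- a)).
by apply: (@bmP _ _ M); [exact: measurableT_comp|move=> s; rewrite normr_id].
Qed.

(** For small h the average over the ball is below e; its length 2h and the normalisation by 2 pi
    leave at most 2 h e / (2 pi) <= e h, and parts of the ball outside the period only help. *)
Lemma lebesgue_pt_mean (f : R -> R) (t e : R) : bounded_measurable f ->
  lebesgue_pt f t -> 0 < e ->
  exists2 h0 : R, 0 < h0 & forall h, 0 < h -> h < h0 ->
    mean (fun s => \1_(ball t h) s * `|f s - f t|) <= e * h.
Proof.
move=> bf; rewrite /lebesgue_pt => lp e0.
have nb : nbhs (0%E : \bar R) [set x | (x < e%:E)%E].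
  by apply: open_nbhs_nbhs; split; [exact: open_ereal_lt_ereal|rewrite /= lte_fin].
have [h0 /= h00 H] := lp _ nb; exists h0 => // h h1 h2.
have {H}/(_ _ h1) := H h; rewrite /= sub0r normrN gtr0_norm// => /(_ h2).
rewrite /davg /iavg lebesgue_measure_ball; last exact: ltW.
rewrite inver gt_eqF ?mulrn_wgt0// => H.
have mc := @measurable_circle R; have p0 := @pi2_gt0 R.
have bi : bounded_measurable (fun s => \1_(ball t h) s * `|f s - f t|).
  apply: bmM; first exact: bm_indic_ball.
  exact: bm_dist.
have le1 : ((2 * pi * mean (fun s => \1_(ball t h) s * `|f s - f t|))%:E <=
    \int[mu]_(y in ball t h) `|((center (f t) \o f) y)%:E|)%E.
  rewrite -meanE; last exact: bm_integrable.
  rewrite integral_mkcond [leRHS]integral_mkcond.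
  apply: ge0_le_integral_nonmeasurable => s _; rewrite /patch.
    by case: ifP => // _; rewrite lee_fin mulr_ge0.
  case: ifP => _; last by case: ifP => //= _; rewrite lee_fin.
  by case: ifP => hs; rewrite indicE hs /= ?mul1r ?mul0r lee_fin.
have le2 : (\int[mu]_(y in ball t h) `|((center (f t) \o f) y)%:E| <= (h *+ 2 * e)%:E)%E.
  rewrite EFinM -lee_pdivrMl ?mulrn_wgt0//; exact: ltW.
have := le_trans le1 le2; rewrite lee_fin => H3.
have pi1 := @pi_ge2 R; have m0 : 0 <= mean (fun s => \1_(ball t h) s * `|f s - f t|).
  by apply: mean_ge0 => s _; rewrite mulr_ge0.
move: H3; rewrite -mulr_natr; nra.
Qed.

(** Near t the kernel lies below a dyadic combination of ball indicators, on which the means of |f -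
    f t| are small in proportion to the radius; away from t it is O(1 - r). Since the kernel has
    mean 1, this controls the distance to f t. *)
Lemma poisson_lebesgue_pt (f : R -> R) (t : R) : bounded_measurable f ->
  0 < t -> t < 2 * pi -> lebesgue_pt f t ->
  mean (fun s => poisson ((r%:C)%C * expi t) s * f s) @[r --> (1 : R)^'-] --> f t.
Proof.
move=> bf t0 t2 lp; have [mf [B hB]] := bf.
have B0 : 0 <= B by apply: le_trans (hB 0).
have c0 : 0 < dyadic_const by rewrite lt_max ltr0n.
apply/cvgrPdist_le => e e0.
(* With this tolerance the j-th ball contributes at most (e / 4) 2^-j, hence e / 2 in total. *)
have eps0 : 0 < e / (4 * dyadic_const) by rewrite divr_gt0// mulr_gt0.
have [h0 h00 Hmean] := lebesgue_pt_mean bf lp eps0.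
have [h [h_gt0 hh0 h1 ht ht2]] : exists h : R, [/\ 0 < h, h < h0, h < 1, h < t & h < 2 * pi - t].
  exists (Num.min (Num.min h0 1) (Num.min t (2 * pi - t)) / 2).
  set m := Num.min _ _.
  have m0 : 0 < m by rewrite !lt_min h00 ltr01 t0 subr_gt0 t2.
  have : m <= m by []; rewrite {2}/m !le_min => /andP[/andP[m1 m2] /andP[m3 m4]].
  by split; lra.
have pi2 := @pi_ge2 R.
have ch : 0 < 1 - cos h.
  rewrite subr_gt0 -[X in _ < X](@cos0 R) ltr_cos ?in_itv /= ?lexx ?pi_ge0//.
  by rewrite (ltW h_gt0) /=; lra.
(* The bound of [poisson_far] without its factor 1 - r, times the bound 2 B on |f s - f t|. *)
pose F := 2 / (1 - cos h) * (2 * B).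
have F0 : 0 <= F by rewrite mulr_ge0 ?divr_ge0 ?mulr_ge0// ltW.
have b0 : 0 < e / (2 * (F + 1)) by rewrite divr_gt0// mulr_gt0//; lra.
near=> r.
have r2 : 1 / 2 <= r by near: r; apply: nbhs_left_ge; lra.
have r1 : r < 1 by near: r; exact: nbhs_left_lt.
have rF : 1 - r <= e / (2 * (F + 1)).
  suff : 1 - e / (2 * (F + 1)) <= r by lra.
  by near: r; apply: nbhs_left_ge; lra.
have {}rF : (1 - r) * F <= e / 2.
  apply: le_trans (ler_wpM2r F0 rF) _.
  rewrite mulrAC ler_pdivrMr; last lra.
  have -> : e / 2 * (2 * (F + 1)) = e * (F + 1) by field.
  by rewrite ler_pM2l//; lra.
set z := (r%:C)%C * expi t.
have zr : cmod z = r by rewrite cmod_circle//; lra.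
have z1 : cmod z < 1 by rewrite zr.
have bP := bm_poisson z1.
pose d := 1 - r; have d0 : 0 < d by rewrite subr_gt0.
pose g s := `|f s - f t|.
have bg : bounded_measurable g by exact: bm_dist.
have g0 s : 0 <= g s by exact: normr_ge0.
have gB s : g s <= 2 * B.
  by apply: le_trans (ler_normB _ _) _; rewrite mulr_natl mulr2n lerD.
have [J hJ] : exists J, h < 2 ^+ J * d.
  exists (Num.bound (h / d)); rewrite -ltr_pdivrMr//.
  have := archi_boundP (divr_ge0 (ltW h_gt0) (ltW d0)) => /lt_le_trans; apply.
  by rewrite -natrX ler_nat ltnW// ltn_expl.
(* The radii are capped at h because the estimate at the Lebesgue point holds only below h0, while
   2^J d exceeds h. *)
pose ind j s : R := \1_(ball t (Num.min (2 ^+ j * d) h)) s.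
have bi j : bounded_measurable (fun s => ind j s * g s).
  by apply: bmM => //; exact: bm_indic_ball.
pose k j : R := dyadic_const / d * 4^-1 ^+ j.
have k0 j : 0 <= k j by rewrite mulr_ge0 ?divr_ge0 ?exprn_ge0 ?invr_ge0 ?ltW.
have pw s : circle s -> poisson z s * g s <=
    (\sum_(0 <= j < J.+1) k j * (ind j s * g s)) + d * F.
  rewrite /circle /= in_itv /= => /andP[s0 s2].
  have i0 j : 0 <= ind j s by rewrite /ind indicE.
  have [near_s|far_s] := ltP `|t - s| h.
    apply: ler_wpDr; first by rewrite mulr_ge0// ltW.
    under eq_bigr do rewrite mulrA; rewrite -mulr_suml ler_wpM2r//.
    apply: le_trans (poisson_near r2 r1 (ltW (lt_trans near_s h1))) _.
    apply: le_trans (dyadic_bound d0 (lt_trans near_s hJ)) _.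
    apply: ler_sum => j _; apply: ler_wpM2l; first exact: k0.
    rewrite /ind !indicE ler_nat; case: (boolP (t - s \in _)) => //.
    rewrite inE /ball /= sub0r normrN => hj.
    by rewrite mem_set//= /ball /= lt_min hj near_s.
  apply: (@le_trans _ _ (d * F)).
    rewrite /F mulrA; apply: ler_pM => //; first exact: poisson_ge0.
    apply: poisson_far => //; first by lra.
    by rewrite ler_norml; apply/andP; split; lra.
  rewrite lerDr sumr_ge0// => j _; rewrite mulr_ge0//; exact: mulr_ge0.
have ft : f t = mean (fun s => poisson z s * f t).
  by under eq_fun do rewrite mulrC; rewrite meanZ ?mean_poisson ?mulr1//; exact: bm_integrable.
rewrite ft -meanN; last by apply: bm_integrable; exact: bmM.
rewrite -meanD; last 2 first.
  by apply: bm_integrable; apply: bmM => //; exact: bm_cst.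
  by apply: bm_integrable; apply: bmN; exact: bmM.
apply: le_trans (mean_norm_le _) _.
  apply: bm_integrable; apply: bmD; [|apply: bmN]; apply: bmM => //; exact: bm_cst.
apply: (@le_trans _ _ (mean (fun s => (\sum_(0 <= j < J.+1) k j * (ind j s * g s)) + d * F))).
  apply: mean_le.
  - apply: ci_norm; apply: bm_integrable; apply: bmD; [|apply: bmN]; apply: bmM => //.
    exact: bm_cst.
  - apply: bm_integrable; apply: bmD; last exact: bm_cst.
    by apply: bm_sum => j; exact: bmZ.
  - move=> s cs; apply: le_trans (pw s cs).
    by rewrite -mulrBr normrM ger0_norm ?poisson_ge0// /g distrC.
rewrite meanD; last 2 first.
  by apply: bm_integrable; apply: bm_sum => j; exact: bmZ.
  by apply: bm_integrable; exact: bm_cst.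
rewrite mean_cst mean_sum; last by move=> j; apply: bm_integrable; exact: bmZ.
have -> : e = e / 2 + e / 2 by field.
apply: lerD => //.
apply: (@le_trans _ _ (\sum_(0 <= j < J.+1) (e / 4) * 2^-1 ^+ j)).
  apply: ler_sum => j _; rewrite meanZ; last exact: bm_integrable.
  have p2 : 0 < 2 ^+ j * d :> R by rewrite mulr_gt0// exprn_gt0.
  have Hj : mean (fun s => ind j s * g s) <= e / (4 * dyadic_const) * (2 ^+ j * d).
    apply: le_trans (Hmean (Num.min (2 ^+ j * d) h) _ _) _.
    - by rewrite lt_min p2.
    - by rewrite gt_min hh0 orbT.
    - by rewrite ler_pM2l// ge_min lexx.
  apply: le_trans (ler_wpM2l (k0 j) Hj) _.
  rewrite le_eqVlt; apply/orP; left; apply/eqP; rewrite /k.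
  have -> : (4^-1 : R) ^+ j = 2^-1 ^+ j * 2^-1 ^+ j by rewrite -exprMn; congr (_ ^+ _); field.
  rewrite exprVn; have : (2 : R) ^+ j != 0 by rewrite gt_eqF// exprn_gt0.
  by move: (2 ^+ j) => q q0; field; rewrite q0 !gt_eqF.
rewrite -mulr_sumr; have h2 : (2^-1 : R) < 1 by lra.
have h20 : 0 <= (2^-1 : R) by lra.
have := sum_geometric_le J.+1 h20 h2.
have -> : (1 - 2^-1)^-1 = 2 :> R by field.
by move=> hs; have := ler_wpM2l (ltW (divr_gt0 e0 (ltr0n _ 4))) hs; lra.
Unshelve. all: by end_near. Qed.

(** At 0 and 2 pi the kernel also peaks at the other end of the interval, so these two points are
    discarded as a null set. *)
Lemma poisson_radial_limit (f : R -> R) : bounded_measurable f ->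
  {ae mu, forall t, circle t ->
    mean (fun s => poisson ((r%:C)%C * expi t) s * f s) @[r --> (1 : R)^'-] --> f t}.
Proof.
move=> bf.
have ne a : {ae mu, forall t, t <> a}.
  exists [set a]; split => //; first exact: lebesgue_measure_set1.
  by move=> t /= /contrapT.
have := ae_and (lebesgue_differentiation (bm_locally_integrable bf))
               (ae_and (ne 0) (ne (2 * pi))).
apply: ae_imp => t [lp [t0 t2]]; rewrite /circle /= in_itv /= => /andP[h0 h2].
apply: poisson_lebesgue_pt => //.
  by rewrite lt_neqAle h0 andbT eq_sym; exact/eqP.
by rewrite lt_neqAle h2 andbT; exact/eqP.
Qed.

End PoissonLimit.

(** * From the Hilbert-Schmidt norm to estimates at each radius *)

Section Necessity.
Variable R : realType.
Local Notation C := R[i].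
Local Notation mu := (@lebesgue_measure R).
Implicit Types (w phi : C -> C).

(** The shift by 2 keeps every radius at least 1/2, so that r^j >= 2^-j uniformly in k. *)
Definition approach_radius (k : nat) : R := 1 - k.+2%:R^-1.

Lemma approach_radius_lt1 k : approach_radius k < 1.
Proof. by rewrite /approach_radius ltrBlDr ltrDl invr_gt0. Qed.

Lemma approach_radius_ge k : 2^-1 <= approach_radius k.
Proof.
have : (k.+2%:R : R)^-1 <= 2^-1 by rewrite lef_pV2 ?posrE// ler_nat.
by rewrite /approach_radius; move: (k.+2%:R^-1) => q; lra.
Qed.

Lemma approach_radius_gt0 k : 0 < approach_radius k.
Proof. by apply: lt_le_trans (approach_radius_ge k); rewrite invr_gt0. Qed.

Lemma cvg_approach_radius : approach_radius k @[k --> \oo] --> (1 : R).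
Proof.
rewrite -[X in _ --> X](subr0 1); apply: cvgB; first exact: cvg_cst.
have := @cvg_harmonic R; rewrite -(cvg_shiftS _ ); exact.
Qed.

Lemma cvg_at_left_radius (f : R -> R) (l : R) :
  f r @[r --> (1 : R)^'-] --> l -> f (approach_radius k) @[k --> \oo] --> l.
Proof.
by move=> /cvg_at_leftP; apply; split; [exact: approach_radius_lt1|exact: cvg_approach_radius].
Qed.

Lemma ccvg_approach_radius (t : R) (r : R) :
  cmod ((r%:C)%C * ((approach_radius k)%:C)%C * expi t - (r%:C)%C * expi t) @[k --> \oo] --> (0 : R).
Proof.
have := @ccvgM R nat \oo _ _ _ _ _ (ccvgM (ccvg_cst (r%:C)%C) _) (ccvg_cst (expi t)).
move=> /(_ _ (fun k => ((approach_radius k)%:C)%C) 1); rewrite mulr1; apply.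
under eq_fun do rewrite -[1](rmorph1 (real_complex R)) -rmorphB cmod_real.
rewrite -(normr0 R) -(subrr (1 : R)); apply: cvg_norm; apply: cvgB; last exact: cvg_cst.
exact: cvg_approach_radius.
Qed.

Lemma H2norm2_ge0 (c : nat -> C) : (0 <= H2norm2 c)%E.
Proof. by apply: nneseries_ge0 => n _ _; rewrite lee_fin exprn_ge0// cmod_ge0. Qed.

Lemma psum_le_H2norm2 (c : nat -> C) N :
  ((\sum_(0 <= n < N) cmod (c n) ^+ 2)%:E <= H2norm2 c)%E.
Proof.
rewrite -sumEFin; apply: nneseries_lim_ge => n _ _.
by rewrite lee_fin exprn_ge0// cmod_ge0.
Qed.

Lemma double_psum_le (b : nat -> nat -> C) K L :
  ((\sum_(0 <= k < K) \sum_(0 <= l < L) cmod (b k l) ^+ 2)%:E <=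
   \sum_(0 <= k <oo) H2norm2 (b k))%E.
Proof.
apply: le_trans (nneseries_lim_ge K _); last by move=> n _ _; exact: H2norm2_ge0.
by rewrite -sumEFin; apply: lee_sum => k _; exact: psum_le_H2norm2.
Qed.

(** The cap N makes the function explicitly bounded, as dominated convergence and the outer function
    estimate demand; it later tends to infinity together with the radius tending to 1. *)
Definition log_radial phi (r : R) (N : R) (t : R) : R :=
  Num.min (- ln (1 - cmod (phi ((r%:C)%C * expi t)))) N.

Lemma bm_log_radial phi (r N : R) : analytic_selfmap phi -> 0 < r -> r < 1 -> 0 <= N ->
  bounded_measurable (log_radial phi r N) /\
  (forall t, 0 <= log_radial phi r N t <= N).
Proof.
move=> [[c hc] hphi] r0 r1 N0.
have x1 t : cmod (phi ((r%:C)%C * expi t)) < 1.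
  by apply: hphi; rewrite cmod_circle// ltW.
have bnd t : 0 <= log_radial phi r N t <= N.
  rewrite /log_radial le_min N0 andbT ge_min lexx orbT andbT oppr_ge0.
  by apply: ln_le0; rewrite gerBl cmod_ge0.
split => //; apply: (@bmP _ _ N); last first.
  by move=> t; have /andP[h1 h2] := bnd t; rewrite ger0_norm.
have [mx _] := cbm_cmod (cbm_disk_series hc (ltW r0) r1).
apply: measurable_minr; last exact: measurable_cst.
apply: measurableT_comp => //; apply: measurableT_comp; first exact: measurable_ln.
exact: measurable_funB.
Qed.

Lemma mean_geometric_le w phi (b : nat -> nat -> C) T (r : R) K :
  (forall n, disk_series (wcomp w phi (fun z => z ^+ n)) (b n)) ->
  (forall K L, \sum_(0 <= k < K) \sum_(0 <= l < L) cmod (b k l) ^+ 2 <= T) ->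
  0 < r -> r < 1 ->
  mean (fun t => \sum_(0 <= k < K)
    cmod (w ((r%:C)%C * expi t) * phi ((r%:C)%C * expi t) ^+ k) ^+ 2) <= T.
Proof.
move=> hb hT r0 r1.
rewrite mean_sum; last first.
  by move=> k; apply: bm_integrable; apply: cbm_sqr; exact: (cbm_disk_series (hb k) (ltW r0) r1).
have c : \sum_(0 <= k < K) \sum_(0 <= l < L) cmod (b k l) ^+ 2 * r ^+ l ^+ 2
    @[L --> \oo] --> \sum_(0 <= k < K)
      mean (fun t => cmod (w ((r%:C)%C * expi t) * phi ((r%:C)%C * expi t) ^+ k) ^+ 2).
  elim: K => [|K IH].
    by under eq_fun do rewrite big_geq//; rewrite big_geq//; exact: cvg_cst.
  under eq_fun do rewrite big_nat_recr//=; rewrite big_nat_recr//=.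
  by apply: cvgD => //; exact: (parseval_disk (hb K) (ltW r0) r1).
apply: (cvgr_to_le c); near=> L; apply: le_trans (hT K L).
apply: ler_sum => k _; apply: ler_sum => l _.
rewrite ler_piMr ?exprn_ge0 ?cmod_ge0//.
by rewrite -exprM exprn_ile1 ?ltW.
Unshelve. all: by end_near. Qed.

Lemma geometric_sum_cvg (y x : R) : 0 <= x -> x < 1 ->
  \sum_(0 <= k < K) y * (x ^+ k) ^+ 2 @[K --> \oo] --> y / (1 - x ^+ 2).
Proof.
move=> x0 x1.
have q1 : `|x ^+ 2| < 1 by rewrite ger0_norm ?exprn_ge0// expr_lt1.
have := cvg_geometric_series (a := y) q1.
apply: cvg_trans; apply: near_eq_cvg; near=> K.
by rewrite /series /=; apply: eq_bigr => k _; rewrite /geometric /= exprAC.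
Unshelve. all: by end_near. Qed.

(** By 1 - x^2 <= 2 (1 - x), half the integrand lies below |w|^2 / (1 - |phi|^2), the limit of the
    geometric sums. *)
Lemma mean_quotient_le w phi c cw (b : nat -> nat -> C) T (r N : R) :
  disk_series phi c -> (forall z, cmod z < 1 -> cmod (phi z) < 1) -> disk_series w cw ->
  (forall n, disk_series (wcomp w phi (fun z => z ^+ n)) (b n)) ->
  (forall K L, \sum_(0 <= k < K) \sum_(0 <= l < L) cmod (b k l) ^+ 2 <= T) ->
  0 < r -> r < 1 -> 0 <= N ->
  mean (fun t => cmod (w ((r%:C)%C * expi t)) ^+ 2 * expR (log_radial phi r N t)) <= 2 * T.
Proof.
move=> hc hphi hw hb hT r0 r1 N0.
pose z t := (r%:C)%C * expi t.
have z1 t : cmod (z t) < 1 by rewrite cmod_circle// ltW.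
pose G t := 2^-1 * (cmod (w (z t)) ^+ 2 * expR (log_radial phi r N t)).
have [bl lb] := bm_log_radial (conj (ex_intro _ c hc) hphi) r0 r1 N0.
have bw : bounded_measurable (fun t => cmod (w (z t)) ^+ 2).
  by apply: cbm_sqr; exact: cbm_disk_series hw (ltW r0) r1.
have be : bounded_measurable (fun t => expR (log_radial phi r N t)).
  apply: (@bmP _ _ (expR N)).
    by case: bl => ml _; apply: measurableT_comp => //; exact: measurable_expR.
  by move=> t; rewrite ger0_norm ?expR_ge0// ler_expR; case/andP: (lb t).
have bG : bounded_measurable G by apply: bmZ; exact: bmM.
have G0 t : 0 <= G t by rewrite !mulr_ge0 ?expR_ge0// ?exprn_ge0 ?cmod_ge0 ?invr_ge0.
pose S K t := \sum_(0 <= k < K) cmod (w (z t) * phi (z t) ^+ k) ^+ 2.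
have bS K : bounded_measurable (S K).
  apply: bm_sum => k; apply: cbm_sqr; exact: (cbm_disk_series (hb k) (ltW r0) r1).
have cS t : S K t @[K --> \oo] --> cmod (w (z t)) ^+ 2 / (1 - cmod (phi (z t)) ^+ 2).
  rewrite /S; under eq_fun => K do under eq_bigr => k _ do rewrite cmodM cmodX exprMn.
  by apply: geometric_sum_cvg; [exact: cmod_ge0|exact: hphi].
have GS t : G t <= cmod (w (z t)) ^+ 2 / (1 - cmod (phi (z t)) ^+ 2).
  rewrite /G mulrCA ler_wpM2l ?exprn_ge0 ?cmod_ge0//.
  set x := cmod (phi (z t)).
  have x1 : x < 1 by exact: hphi.
  have x0 : 0 <= x by exact: cmod_ge0.
  have d0 : 0 < 1 - x by lra.
  have d1 : 0 < 1 - x ^+ 2 by rewrite subr_gt0 expr_lt1.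
  apply: (@le_trans _ _ (2^-1 * (1 - x)^-1)).
    rewrite ler_wpM2l ?invr_ge0//.
    apply: (@le_trans _ _ (expR (- ln (1 - x)))).
      by rewrite ler_expR /log_radial ge_min lexx.
    by rewrite expRN lnK.
  rewrite -invfM lef_pV2 ?posrE ?mulr_gt0//.
  by nra.
have [mG [B hB]] := bG.
(* Capping the partial sums by the bounded [G] permits dominated convergence; as their limit is at
   least [G], the capped sums still converge to [G]. *)
have cm : mean (fun t => Num.min (S K t) (G t)) @[K --> \oo] --> mean G.
  apply: (@mean_bounded_cvg _ _ _ B) => //.
  - by move=> K; have [mS _] := bS K; exact: measurable_minr.
  - move=> K t; rewrite ger0_norm.
      by apply: le_trans (hB t); rewrite ger0_norm// ge_min lexx orbT.
    rewrite le_min G0 andbT sumr_ge0// => k _; by rewrite exprn_ge0// cmod_ge0.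
  - apply: aeW => t _; apply/cvgrPdist_le => e e0.
    have /cvgrPdist_le /(_ e e0) := cS t; apply: filterS => K.
    rewrite ler_norml => /andP[_ h]; have h2 := GS t.
    case: (leP (S K t) (G t)) => h3; last by rewrite subrr normr0 ltW.
    rewrite ger0_norm ?subr_ge0//; lra.
have : mean G <= T.
  apply: (cvgr_to_le cm); near=> K.
  apply: le_trans (mean_geometric_le K hb hT r0 r1).
  apply: mean_le.
  - apply: bm_integrable; apply: (@bmP _ _ B).
      by have [mS _] := bS K; exact: measurable_minr.
    move=> t; rewrite ger0_norm.
      by apply: le_trans (hB t); rewrite ger0_norm// ge_min lexx orbT.
    rewrite le_min G0 andbT sumr_ge0// => k _; by rewrite exprn_ge0// cmod_ge0.
  - exact: (bm_integrable (bS K)).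
  - by move=> t _; rewrite ge_min lexx.
rewrite /G meanZ; last by apply: bm_integrable; exact: bmM.
by rewrite -/z; lra.
Unshelve. all: by end_near. Qed.

(* Bessel's inequality for the [j]-th coefficient of [w(r z) W(z)], where [W] is the outer
   function with [|W|^2 = e^v] on the circle. *)
Lemma coefficient_log_bound w (a : nat -> C) (v : R -> R) (r B : R) j :
  disk_series w a -> (forall i, (i < j)%N -> a i = 0) -> 0 < r -> r < 1 ->
  bounded_measurable v -> (forall t, 0 <= v t <= B) ->
  cmod (a j) ^+ 2 * (r ^+ j) ^+ 2 * expR (mean v) <=
  mean (fun t => cmod (w ((r%:C)%C * expi t)) ^+ 2 * expR (v t)).
Proof.
move=> hw aj0 r0 r1 bv vB.
have [W [e [hW WP e0]]] := outer_function (bm_integrable bv).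
have hs := disk_series_scale (ltW r0) (ltW r1) hw.
have hg := disk_seriesM hs hW.
(* The coefficients of w below j vanish, so only one product survives, and its factor [e 0] carries
   exp (mean v). *)
have cj : cauchy_prod (fun n => a n * (r%:C)%C ^+ n) e j = a j * (r%:C)%C ^+ j * e 0%N.
  rewrite /cauchy_prod big_ord_recr /= subnn big1 ?add0r// => i _.
  by rewrite aj0// !mul0r.
(* Bounds for the dominated limit in k: |w| <= M on the disk of radius r, and the Poisson integral
   of v is at most B. *)
have [M hM] := disk_series_abs_summable hw (ltW r0) r1.
have wM z : cmod z <= r -> cmod (w z) <= M.
  by move=> zr; exact: disk_series_bound hw r0 r1 zr hM.
have M0 : 0 <= M by apply: le_trans (cmod_ge0 (w 0)) (wM _ _); rewrite cmod0 ltW.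
have PB z : cmod z < 1 -> mean (fun s => poisson z s * v s) <= B.
  move=> z1; have bP := bm_poisson z1.
  apply: (@le_trans _ _ (mean (fun s => B * poisson z s))); last first.
    by rewrite meanZ ?mean_poisson ?mulr1//; exact: bm_integrable.
  apply: mean_le; [exact/bm_integrable/bmM|exact/bm_integrable/bmZ|].
  move=> s _; rewrite mulrC ler_wpM2r ?poisson_ge0//; by case/andP: (vB s).
(* [W] lives inside the disk, so a second radius tends to 1. Only |W|^2 = exp P[v] needs a boundary
   limit, and it has one almost everywhere. *)
pose zk k t := ((approach_radius k)%:C)%C * expi t.
have zk1 k t : cmod (zk k t) < 1 by rewrite cmod_circle ?approach_radius_lt1// ltW// approach_radius_gt0.
pose g k t := cmod (w ((r%:C)%C * zk k t) * W (zk k t)) ^+ 2.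
have bg k : bounded_measurable (g k).
  by apply: cbm_sqr; exact: (cbm_disk_series hg (ltW (approach_radius_gt0 k)) (approach_radius_lt1 k)).
have gE k t : g k t = cmod (w ((r%:C)%C * zk k t)) ^+ 2 *
    expR (mean (fun s => poisson (zk k t) s * v s)).
  by rewrite /g cmodM exprMn WP.
have be : bounded_measurable (fun t => cmod (w ((r%:C)%C * expi t)) ^+ 2 * expR (v t)).
  apply: bmM; first by apply: cbm_sqr; exact: cbm_disk_series hw (ltW r0) r1.
  apply: (@bmP _ _ (expR B)).
    by case: bv => mv _; apply: measurableT_comp => //; exact: measurable_expR.
  by move=> t; rewrite ger0_norm ?expR_ge0// ler_expR; case/andP: (vB t).
have cg : mean (g k) @[k --> \oo] -->
    mean (fun t => cmod (w ((r%:C)%C * expi t)) ^+ 2 * expR (v t)).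
  apply: (@mean_bounded_cvg _ _ _ (M ^+ 2 * expR B)).
  - by move=> k; case: (bg k).
  - by case: be.
  - move=> k t; rewrite gE ger0_norm ?mulr_ge0 ?exprn_ge0 ?cmod_ge0 ?expR_ge0//.
    apply: ler_pM; rewrite ?exprn_ge0 ?cmod_ge0 ?expR_ge0//.
      rewrite ler_pXn2r ?nnegrE ?cmod_ge0// wM//.
      by rewrite cmodM cmod_real gtr0_norm// ler_piMr// ltW.
    by rewrite ler_expR PB.
  - apply: ae_imp (poisson_radial_limit bv) => t h ct.
    have hP := cvg_at_left_radius (h ct).
    under eq_fun => k do rewrite gE.
    apply: cvgM.
      under eq_fun do rewrite expr2; rewrite expr2.
      have hcw : cmod (w ((r%:C)%C * zk k t)) @[k --> \oo] --> cmod (w ((r%:C)%C * expi t)).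
        apply: cvg_cmod; apply: disk_series_continuous hw _ _.
          by rewrite cmod_circle// ltW.
        by under eq_fun do rewrite /zk mulrA; exact: ccvg_approach_radius.
      exact: cvgM.
    apply: (cvg_comp _ _ hP); exact: continuous_expR.
pose c := cmod (a j) ^+ 2 * (r ^+ j) ^+ 2 * expR (mean v).
have low k : c * (approach_radius k ^+ j) ^+ 2 <= mean (g k).
  apply: le_trans (bessel_disk j.+1 hg (ltW (approach_radius_gt0 k)) (approach_radius_lt1 k)).
  rewrite big_nat_recr//= cj; apply: ler_wpDl.
    by apply: sumr_ge0 => i _; rewrite mulr_ge0 ?exprn_ge0 ?cmod_ge0 ?ltW ?approach_radius_gt0.
  rewrite /c -e0 !cmodM cmodX cmod_real gtr0_norm// !exprMn.
  by rewrite le_eqVlt; apply/orP; left; apply/eqP; ring.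
have cl : c * (approach_radius k ^+ j) ^+ 2 @[k --> \oo] --> c * (1 ^+ j) ^+ 2.
  apply: cvgMr; under eq_fun do rewrite -exprM; rewrite -exprM.
  elim: (j * 2)%N => [|n IH]; first by under eq_fun do rewrite expr0; exact: cvg_cst.
  by under eq_fun do rewrite exprS; rewrite exprS; apply: cvgM => //; exact: cvg_approach_radius.
have := ler_cvg_to cl cg; rewrite !expr1n mulr1; apply.
by near=> k; exact: low.
Unshelve. all: by end_near. Qed.

End Necessity.

(** * Passage from the radii to the boundary integrand *)

Section LogIntegrand.
Variable R : realType.
Local Notation C := R[i].
Local Notation mu := (@lebesgue_measure R).
Implicit Types (w phi : C -> C).

Lemma limn_einf_ge (u : nat -> \bar R) y :
  (\forall k \near \oo, (y <= u k)%E) -> (y <= limn_einf u)%E.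
Proof.
move=> [N _ hN]; rewrite limn_einf_lim; apply: lime_ge; first exact: is_cvg_einfs.
near=> n; apply: le_ereal_inf_tmp => _ [k /= nk <-]; apply: hN => /=.
by apply: leq_trans nk; near: n; exact: nbhs_infty_ge.
Unshelve. all: by end_near. Qed.

Lemma limn_einf_le (u : nat -> \bar R) y :
  (forall k, (u k <= y)%E) -> (limn_einf u <= y)%E.
Proof.
move=> h; rewrite limn_einf_lim; apply: lime_le; first exact: is_cvg_einfs.
near=> n; apply: ge_ereal_inf; exists (u n) => //; by exists n => /=.
Unshelve. all: by end_near. Qed.

Lemma phistar_eq phi t L : radial_limit phi t L -> phistar phi t = L.
Proof.
move=> h; rewrite /phistar; case: xgetP => [x _ hx|/(_ L) //].
exact: ccvg_unique hx h.
Qed.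

Lemma log_integrand_ge0 phi t : (0 <= log_integrand phi t)%E.
Proof.
rewrite /log_integrand; case: ifP => // h; rewrite lee_fin ln_ge0//.
by rewrite invf_ge1 ?subr_gt0// gerBl cmod_ge0.
Qed.

Lemma log_integrand_gt phi t (y : R) :
  (y%:E < log_integrand phi t)%E -> 1 - expR (- y) < cmod (phistar phi t).
Proof.
rewrite /log_integrand; case: ifP => [h|/negbT].
  have d0 : 0 < 1 - cmod (phistar phi t) by rewrite subr_gt0.
  rewrite lte_fin lnV ?posrE// ltrNr => h2.
  have : ln (1 - cmod (phistar phi t)) < ln (expR (- y)) by rewrite expRK.
  by rewrite ltr_ln ?posrE ?expR_gt0//; lra.
by rewrite -leNgt => h _; apply: lt_le_trans h; rewrite gtrBl expR_gt0.
Qed.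

(** Testing against every real y below the integrand treats finite and infinite values alike. *)
Lemma log_integrand_le_liminf phi t :
  (forall z, cmod z < 1 -> cmod (phi z) < 1) ->
  (log_integrand phi t <=
   limn_einf (fun k => (log_radial phi (approach_radius R k) k%:R t)%:E))%E.
Proof.
move=> hphi.
have z1 k : cmod (((approach_radius R k)%:C)%C * expi t) < 1.
  by rewrite cmod_circle ?approach_radius_lt1// ltW// approach_radius_gt0.
have b0 : (0 <= limn_einf (fun k => (log_radial phi (approach_radius R k) k%:R t)%:E))%E.
  apply: limn_einf_ge; near=> k; rewrite lee_fin /log_radial le_min ler0n andbT.
  by rewrite oppr_ge0; apply: ln_le0; rewrite gerBl cmod_ge0.
(* Without a radial limit [phistar] is 0, so the integrand is ln 1 = 0, and the lower limit is
   nonnegative. *)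
have [hL|noL] := pselect (exists L, radial_limit phi t L); last first.
  rewrite /log_integrand /phistar.
  case: xgetP => [x _ hx|_]; first by case: noL; exists x.
  by rewrite cmod0 ltr01 subr0 invr1 ln1.
have [L' {}hL] := hL; have pE := phistar_eq hL.
have key (y : R) : (y%:E < log_integrand phi t)%E ->
    (y%:E <= limn_einf (fun k => (log_radial phi (approach_radius R k) k%:R t)%:E))%E.
  move=> /log_integrand_gt; rewrite pE => yL.
  have cx : cmod (phi (((approach_radius R k)%:C)%C * expi t)) @[k --> \oo] --> cmod L'.
    exact: cvg_at_left_radius (cvg_cmod hL).
  apply: limn_einf_ge; near=> k; rewrite lee_fin /log_radial le_min.
  apply/andP; split; last by near: k; exact: nbhs_infty_ger.
  have xk : 1 - expR (- y) < cmod (phi (((approach_radius R k)%:C)%C * expi t)).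
    by near: k; exact: (cvgr_gt _ cx).
  have d0 : 0 < 1 - cmod (phi (((approach_radius R k)%:C)%C * expi t)) by rewrite subr_gt0 hphi.
  by rewrite lerNr -[leRHS]expRK ler_ln ?posrE ?expR_gt0//; lra.
rewrite leNgt; apply/negP.
case E : (limn_einf _) b0 key => [b| |] // b0 key; last by rewrite ltNge leey.
case El : (log_integrand phi t) key => [l| |] // key.
  rewrite lte_fin => bl; have : (((b + l) / 2)%:E <= b%:E)%E.
    by apply: key; rewrite lte_fin; lra.
  by rewrite lee_fin; lra.
move=> _; have : ((b + 1)%:E <= b%:E)%E by apply: key; rewrite ltry.
by rewrite lee_fin; lra.
Unshelve. all: by end_near. Qed.

Lemma exists_first_coef (a : nat -> C) w z :
  disk_series w a -> cmod z < 1 -> w z != 0 ->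
  exists j, a j != 0 /\ forall i, (i < j)%N -> a i = 0.
Proof.
move=> hw z1 wz.
have exj : exists j, a j != 0.
  apply: contrapT => h; move/eqP: wz; apply.
  apply: (@ccvg_unique R nat \oo _ (fun N => \sum_(0 <= n < N) a n * z ^+ n)).
    exact: hw.
  apply: cvg_near_cst; near=> N; rewrite big1 ?subrr ?cmod0// => n _.
  by have [->|an] := eqVneq (a n) 0; [rewrite mul0r|case: h; exists n].
case: (ex_minnP exj) => j aj minj; exists j; split => // i ij.
by apply/eqP; apply: contraTT ij => /minj; rewrite -leqNgt.
Unshelve. all: by end_near. Qed.

(** Radius and cap are driven by the same index k, so a single use of Fatou's lemma removes both. *)
Theorem HS_log_integrable w phi : analytic_selfmap phi -> inH2 w ->
  (exists z, cmod z < 1 /\ w z != 0) -> wcomp_HS w phi ->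
  (circle_integral (log_integrand phi) < +oo)%E.
Proof.
move=> hphi [a [hw _]] [z [z1 wz]] [_ [b [hb hT]]].
have [[c hc] phi1] := hphi.
have [j [aj a0]] := exists_first_coef hw z1 wz.
pose T := fine (\sum_(0 <= n <oo) H2norm2 (b n))%E.
have TE : (\sum_(0 <= n <oo) H2norm2 (b n))%E = T%:E.
  rewrite fineK// ge0_fin_numE//.
  by apply: nneseries_ge0 => n _ _; exact: H2norm2_ge0.
have hTT K L : \sum_(0 <= k < K) \sum_(0 <= l < L) cmod (b k l) ^+ 2 <= T.
  by rewrite -lee_fin -TE; exact: double_psum_le.
(* A lower bound for |a_j r^j|^2 valid for all the radii at once. *)
pose q : R := cmod (a j) ^+ 2 * (2^-1 ^+ j) ^+ 2.
have q0 : 0 < q.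
  rewrite mulr_gt0 ?exprn_gt0// ?invr_gt0// lt_neqAle eq_sym cmod_eq0 aj.
  exact: cmod_ge0.
have bound k : mean (log_radial phi (approach_radius R k) k%:R) <= ln (2 * T / q).
  have r0 := approach_radius_gt0 R k; have r1 := approach_radius_lt1 R k.
  have [bv vB] := bm_log_radial hphi r0 r1 (ler0n R k).
  have := le_trans (coefficient_log_bound hw a0 r0 r1 bv vB)
    (mean_quotient_le hc phi1 hw hb hTT r0 r1 (ler0n R k)).
  set m := mean _ => h.
  have h2 : q * expR m <= 2 * T.
    apply: le_trans h; rewrite ler_wpM2r ?expR_ge0// /q ler_wpM2l ?exprn_ge0 ?cmod_ge0//.
    rewrite -!exprM lerXn2r ?nnegrE ?invr_ge0 ?(ltW r0)//; exact: approach_radius_ge.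
  (* Positivity of T is read off the estimate itself, before taking logarithms. *)
  have T0 : 0 < 2 * T by apply: lt_le_trans h2; rewrite mulr_gt0 ?expR_gt0.
  rewrite -(expRK m) ler_ln ?posrE ?expR_gt0 ?divr_gt0//.
  by rewrite ler_pdivlMr// mulrC.
have mc := @measurable_circle R.
have F := @fatou _ _ _ mu (@circle R) mc
  (fun k t => (log_radial phi (approach_radius R k) k%:R t)%:E).
have le1 : (\int[mu]_(t in @circle R) log_integrand phi t <=
    (2 * pi * ln (2 * T / q))%:E)%E.
  apply: (@le_trans _ _ (\int[mu]_(t in @circle R)
      limn_einf (fun k => (log_radial phi (approach_radius R k) k%:R t)%:E))%E).
    apply: ge0_le_integral_nonmeasurable => t _; first exact: log_integrand_ge0.
    exact: log_integrand_le_liminf.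
  apply: le_trans (F _ _) _.
  - move=> k; have [[mv _] _] := bm_log_radial hphi (approach_radius_gt0 R k) (approach_radius_lt1 R k) (ler0n R k).
    by apply/measurable_EFinP; apply: measurable_funTS; exact: mv.
  - move=> k t _; rewrite lee_fin.
    have [_ vB] := bm_log_radial hphi (approach_radius_gt0 R k) (approach_radius_lt1 R k) (ler0n R k).
    by case/andP: (vB t).
  apply: limn_einf_le => k.
  have [bv _] := bm_log_radial hphi (approach_radius_gt0 R k) (approach_radius_lt1 R k) (ler0n R k).
  rewrite meanE; last exact: bm_integrable.
  by rewrite lee_fin ler_pM2l ?pi2_gt0.
rewrite /circle_integral; apply: (@le_lt_trans _ _ (((2 * pi)^-1)%:E *
  (2 * pi * ln (2 * T / q))%:E)%E); last by rewrite -EFinM ltry.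
by rewrite lee_wpmul2l// lee_fin invr_ge0 ltW// pi2_gt0.
Qed.

End LogIntegrand.

(** * Fatou's theorem for analytic self-maps of the disk *)

Section Fatou.
Variable R : realType.
Local Notation C := R[i].
Local Notation mu := (@lebesgue_measure R).
Implicit Types (phi : C -> C).

Definition energy phi (r : R) : R := mean (fun t => cmod (phi ((r%:C)%C * expi t)) ^+ 2).

(** On each coefficient, (s^n - r^n)^2 <= s^(2n) - r^(2n) because 0 <= r^n <= s^n; Parseval's
    identity does the rest. *)
Lemma energy_diff phi c (r s : R) : disk_series phi c -> 0 <= r -> r <= s -> s < 1 ->
  mean (fun t => cmod (phi ((s%:C)%C * expi t) - phi ((r%:C)%C * expi t)) ^+ 2) <=
  energy phi s - energy phi r.
Proof.
move=> hc r0 rs s1; have s0 := le_trans r0 rs; have r1 := le_lt_trans rs s1.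
have [[M hM] hg] := disk_series_trig hc s0 s1.
have [[N hN] hh] := disk_series_trig hc r0 r1.
pose a n := c n * (s%:C)%C ^+ n - c n * (r%:C)%C ^+ n.
have aMN K : \sum_(0 <= n < K) cmod (a n) <= M + N.
  apply: le_trans (lerD (hM K) (hN K)); rewrite -big_split /=.
  by apply: ler_sum => n _; exact: cmod_le_sub.
have ha t : cmod (\sum_(0 <= n < K) a n * expi t ^+ n -
    (phi ((s%:C)%C * expi t) - phi ((r%:C)%C * expi t))) @[K --> \oo] --> (0 : R).
  have h2 : cmod (- (\sum_(0 <= n < K) c n * (r%:C)%C ^+ n * expi t ^+ n) -
      - phi ((r%:C)%C * expi t)) @[K --> \oo] --> (0 : R).
    by under eq_fun do rewrite -opprD cmodN; exact: hh.
  apply: cvg_trans (ccvgD (hg t) h2); apply: near_eq_cvg; near=> K.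
  by rewrite -sumrB; congr (cmod (_ - _)); apply: eq_bigr => n _; rewrite mulrBl.
have p1 := parseval aMN ha.
have p2 : (\sum_(0 <= n < K) cmod (c n) ^+ 2 * s ^+ n ^+ 2 -
    \sum_(0 <= n < K) cmod (c n) ^+ 2 * r ^+ n ^+ 2) @[K --> \oo] -->
    energy phi s - energy phi r.
  by apply: cvgB; exact: parseval_disk.
apply: (ler_cvg_to p1 p2); near=> K.
rewrite -sumrB; apply: ler_sum => n _.
have -> : a n = c n * ((s ^+ n - r ^+ n)%:C)%C by rewrite rmorphB /= !rmorphXn mulrBr.
rewrite cmodM exprMn cmod_real real_normK ?num_real// -mulrBr ler_wpM2l ?exprn_ge0 ?cmod_ge0//.
have rsn : r ^+ n <= s ^+ n by rewrite lerXn2r ?nnegrE.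
have rn : 0 <= r ^+ n by rewrite exprn_ge0.
by move: (r ^+ n) (s ^+ n) rsn rn => x y; nra.
Unshelve. all: by end_near. Qed.

Lemma energy_le1 phi c (r : R) : disk_series phi c ->
  (forall z, cmod z < 1 -> cmod (phi z) < 1) -> 0 <= r -> r < 1 -> energy phi r <= 1.
Proof.
move=> hc hphi r0 r1; rewrite -(@mean_cst R 1); apply: mean_le.
- by apply: bm_integrable; apply: cbm_sqr; exact: cbm_disk_series hc r0 r1.
- exact/bm_integrable/bm_cst.
- by move=> t _; rewrite exprn_ile1 ?cmod_ge0// ltW// hphi// cmod_circle.
Qed.

Lemma energy_mono phi c (r s : R) : disk_series phi c -> 0 <= r -> r <= s -> s < 1 ->
  energy phi r <= energy phi s.
Proof.
move=> hc r0 rs s1; rewrite -subr_ge0; apply: le_trans (energy_diff hc r0 rs s1).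
by apply: mean_ge0 => t _; rewrite exprn_ge0// cmod_ge0.
Qed.

(** The energy is monotone and at most 1; radii with energy within 4^-k of its supremum have L2
    steps small enough to bear a weight 2^k. *)
Lemma fast_radii phi c : disk_series phi c ->
  (forall z, cmod z < 1 -> cmod (phi z) < 1) ->
  exists rho : nat -> R, [/\ forall k, 0 < rho k /\ rho k < 1,
    rho k @[k --> \oo] --> (1 : R) &
    forall k, mean (fun t => cmod (phi (((rho k.+1)%:C)%C * expi t) -
                                   phi (((rho k)%:C)%C * expi t)) ^+ 2) <= 4^-1 ^+ k].
Proof.
move=> hc hphi.
pose A : set R := [set energy phi r | r in [set r | 0 <= r < 1]].
have hA : has_sup A.
  split; first by exists (energy phi 0), 0 => //=; rewrite lexx ltr01.
  by exists 1 => _ [r /= /andP[r0 r1] <-]; exact: energy_le1 hc hphi r0 r1.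
have ex k : exists r : R, [/\ approach_radius R k <= r, r < 1 &
    sup A - 4^-1 ^+ k < energy phi r].
  have p0 : 0 < (4^-1 : R) ^+ k by rewrite exprn_gt0// invr_gt0.
  have [_ [r /= /andP[r0 r1] <-] hr] := sup_adherent p0 hA.
  (* The maximum forces the radii to tend to 1; monotonicity of the energy preserves
     near-optimality. *)
  exists (Num.max r (approach_radius R k)); split.
  - by rewrite le_max lexx orbT.
  - by rewrite gt_max r1 approach_radius_lt1.
  - apply: lt_le_trans hr _; apply: energy_mono hc r0 _ _; first by rewrite le_max lexx.
    by rewrite gt_max r1 approach_radius_lt1.
have [rho hrho] := choice ex; exists rho.
have r0 k : 0 < rho k.
  by have [h _ _] := hrho k; apply: lt_le_trans h; exact: approach_radius_gt0.
have r1 k : rho k < 1 by have [] := hrho k.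
have top k : energy phi (rho k) <= sup A.
  by apply: ub_le_sup; [exact: hA.2|exists (rho k) => //=; rewrite r1 ltW].
split => //.
  apply: (squeeze_cvgr _ (@cvg_approach_radius R) (cvg_cst (1 : R))).
  by near=> k; have [h1 h2 _] := hrho k; rewrite h1 ltW.
move=> k; have [_ _ e1] := hrho k; have [_ _ e2] := hrho k.+1.
have p4 : (4^-1 : R) ^+ k.+1 <= 4^-1 ^+ k.
  by rewrite exprS ler_piMl ?exprn_ge0 ?invr_ge0//; lra.
have t1 := top k; have t2 := top k.+1.
(* The chosen radii need not increase, so both orders are treated. *)
have [le|/ltW le] := leP (rho k) (rho k.+1).
  apply: le_trans (energy_diff hc (ltW (r0 _)) le (r1 _)) _; lra.
under eq_fun do rewrite cmodB.
apply: le_trans (energy_diff hc (ltW (r0 _)) le (r1 _)) _; lra.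
Unshelve. all: by end_near. Qed.

(** Against means of size 4^-k the weights 2^k leave a convergent series, so the weighted sum is
    integrable and hence finite almost everywhere. A measurable set of good points is returned so
    that its indicator can be used. *)
Lemma ae_bounded_series (D : nat -> R -> R) :
  (forall k, bounded_measurable (D k)) -> (forall k t, 0 <= D k t) ->
  (forall k, mean (D k) <= 4^-1 ^+ k) ->
  exists A : set R, [/\ measurable A, {ae mu, forall t, circle t -> A t} &
    forall t, A t -> exists M, forall K, \sum_(0 <= k < K) 2 ^+ k * D k t <= M].
Proof.
move=> bD D0 mD.
pose H t := (\sum_(0 <= k <oo) (2 ^+ k * D k t)%:E)%E.
have t0 k t : (0 <= (2 ^+ k * D k t)%:E)%E by rewrite lee_fin mulr_ge0 ?exprn_ge0.
have mt k : measurable_fun setT (fun t => (2 ^+ k * D k t)%:E).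
  by apply/measurable_EFinP; have [] := bmZ (2 ^+ k) (bD k).
have mH : measurable_fun setT H.
  by apply: ge0_emeasurable_sum.
exists [set t | (H t < +oo)%E]; split.
- by rewrite -[X in measurable X]setTI; apply: emeasurable_fun_infty_o.
- have mc := @measurable_circle R.
  have iH : mu.-integrable (@circle R) H.
    apply/integrableP; split; first exact: measurable_funTS.
    under eq_integral do rewrite gee0_abs ?nneseries_ge0//.
    rewrite /H integral_nneseries//; last by move=> k; apply: measurable_funTS; exact: mt.
    apply: (@le_lt_trans _ _ (2 * pi * 2)%:E); last by rewrite ltry.
    apply: lime_le.
      by apply: is_cvg_nneseries => k _ _; apply: integral_ge0 => t _.
    near=> K.
    have -> : (\sum_(0 <= k < K) \int[mu]_(x in @circle R) (2 ^+ k * D k x)%:E)%E =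
      (\sum_(0 <= k < K) 2 * pi * (2 ^+ k * mean (D k)))%:E.
      rewrite -sumEFin; apply: eq_bigr => k _; rewrite meanE; last exact/bm_integrable/bmZ.
      by rewrite meanZ//; exact: bm_integrable.
    rewrite lee_fin -mulr_sumr ler_pM2l ?pi2_gt0//.
    apply: (@le_trans _ _ (\sum_(0 <= k < K) 2^-1 ^+ k)); last first.
      have h20 : 0 <= (2^-1 : R) by lra.
      have h21 : (2^-1 : R) < 1 by lra.
      apply: le_trans (sum_geometric_le K h20 h21) _.
      by have -> : (1 - 2^-1)^-1 = 2 :> R by field.
    apply: ler_sum => k _; apply: le_trans (ler_wpM2l _ (mD k)) _; first by rewrite exprn_ge0.
    by rewrite -exprMn (_ : 2 * 4^-1 = 2^-1 :> R) //; field.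
  apply: ae_imp (@integrable_ae _ _ _ mu (@circle R) mc _ iH) => t h /h.
  rewrite ge0_fin_numE//; exact: nneseries_ge0.
- move=> t /= Ht; exists (fine (H t)) => K.
  rewrite -lee_fin fineK; last by rewrite ge0_fin_numE//; exact: nneseries_ge0.
  by rewrite -sumEFin; apply: nneseries_lim_ge.
Unshelve. all: by end_near. Qed.

(** Along the chosen radii the increments are absolutely summable at almost every point, so the
    values converge there. *)
Lemma fatou_boundary phi : analytic_selfmap phi ->
  exists (rho : nat -> R) (g : R -> C),
  [/\ forall k, 0 < rho k /\ rho k < 1, rho k @[k --> \oo] --> (1 : R), cbm g &
    {ae mu, forall t, circle t ->
      cmod (phi (((rho k)%:C)%C * expi t) - g t) @[k --> \oo] --> (0 : R)}].
Proof.
move=> [[c hc] hphi].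
have [rho [r01 r1 hr]] := fast_radii hc hphi.
pose f k t := phi (((rho k)%:C)%C * expi t).
have z1 k t : cmod (((rho k)%:C)%C * expi t) < 1.
  by have [r0 rl] := r01 k; rewrite cmod_circle// ltW.
have bf k : cbm (f k) by have [r0 rl] := r01 k; exact: cbm_disk_series hc (ltW r0) rl.
pose D k t := cmod (f k.+1 t - f k t) ^+ 2.
have bD k : bounded_measurable (D k).
  apply: cbm_sqr; apply: cbmD => //.
  by under eq_fun do rewrite -mulN1r; apply: cbmM => //; exact: cbm_cst.
have D0 k t : 0 <= D k t by rewrite exprn_ge0// cmod_ge0.
have [A [mA aeA hA]] := ae_bounded_series bD D0 hr.
have cvA t : A t -> exists l, cmod (f k t - l) @[k --> \oo] --> (0 : R).
  move=> /hA [M hM].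
  have [|l hl] := @bounded_sum_ccvg _ (fun k => f k.+1 t - f k t) (2 + M).
    (* From q (1/q - x)^2 >= 0 with q = 2^k comes x <= 1/q + q x^2, which turns the weighted square
       sums into a bound on the sum of the moduli. *)
    move=> K; apply: (@le_trans _ _ (\sum_(0 <= k < K) (2^-1 ^+ k + 2 ^+ k * D k t))).
      apply: ler_sum => k _; rewrite /D; move: (cmod _) (cmod_ge0 (f k.+1 t - f k t)) => x x0.
      have q0 : 0 < (2 : R) ^+ k by rewrite exprn_gt0.
      rewrite exprVn; move: (2 ^+ k) q0 => q q0.
      have iq : 0 < q^-1 by rewrite invr_gt0.
      have : q^-1 * q = 1 by rewrite mulVf// gt_eqF.
      have := sqr_ge0 (q^-1 - x).
      rewrite -(ler_pM2l q0); move: (q^-1) iq => p p0 h1 h2.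
      have h3 : q * (p - x) ^+ 2 = p - 2 * x + q * x ^+ 2 by rewrite sqrrB; move: h2; nra.
      have h4 : 0 <= q * (p - x) ^+ 2 by rewrite mulr_ge0// ltW.
      by rewrite ler_pM2l//; lra.
    rewrite big_split /= lerD//.
    have h20 : 0 <= (2^-1 : R) by lra.
    have h21 : (2^-1 : R) < 1 by lra.
    apply: le_trans (sum_geometric_le K h20 h21) _.
    by have -> : (1 - 2^-1)^-1 = 2 :> R by field.
  exists (f 0%N t + l).
  apply: cvg_trans (ccvgD (ccvg_cst (f 0%N t)) hl); apply: near_eq_cvg; near=> K.
  by rewrite (telescope_sumr (fun k => f k t))//; congr (cmod _); ring.
(* Multiplying by the indicator of A makes the sequence converge at every point, so its limit is
   measurable and bounded. *)
pose h k t := ((\1_A t : R)%:C)%C * f k t.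
have bh k : cbm (h k).
  apply: cbmM => //; split => /=; last exact: bm_cst.
  apply: (@bmP _ _ 1); first exact: measurable_indic.
  by move=> t; rewrite indicE; case: (_ \in _) => /=; rewrite ?normr1 ?normr0.
have exg t : exists l, cmod (h k t - l) @[k --> \oo] --> (0 : R).
  have [At|nA] := pselect (A t).
    have [l hl] := cvA t At; exists l.
    by under eq_fun do rewrite /h indicE mem_set// mul1r.
  exists 0; under eq_fun do rewrite /h indicE memNset// mul0r.
  exact: ccvg_cst.
have [g hg] := choice exg; exists rho, g; split => //.
- have [m1 m2] := measurable_ccvg bh hg; apply: (@cbm_bound _ _ 1 m1 m2) => t.
  apply: (cvgr_to_le (cvg_cmod (hg t))); near=> k.
  rewrite /h cmodM cmod_real; have x1 := ltW (hphi _ (z1 k t)).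
  rewrite indicE; case: (_ \in _) => /=; rewrite ?normr1 ?normr0 ?mul1r ?mul0r//.
- apply: ae_imp aeA => t hAt /hAt At; have := hg t.
  by under eq_fun do rewrite /h indicE mem_set// mul1r.
Unshelve. all: by end_near. Qed.

(** The limit along one sequence of radii already represents phi as a Poisson integral; Poisson
    integrals then have limits along the full radius. The multiplier [eta] extracts real and
    imaginary parts here, and rotates the value of phi to its modulus later. *)
Theorem fatou_radial phi : analytic_selfmap phi ->
  exists g : R -> C, [/\ cbm g,
    {ae mu, forall t, circle t -> radial_limit phi t (g t)} &
    forall (eta z : C), cmod z < 1 ->
      mean (fun s => poisson z s * Re (eta * g s)) = Re (eta * phi z)].
Proof.
move=> hphi; have [rho [g [r01 r1 bg aeg]]] := fatou_boundary hphi.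
have [[c hc] phi1] := hphi.
exists g.
have rep (eta z : C) : cmod z < 1 ->
    mean (fun s => poisson z s * Re (eta * g s)) = Re (eta * phi z).
  move=> z1; have [mP [B hB]] := bm_poisson z1.
  have he := disk_seriesZ eta hc.
  have E k : mean (fun s => poisson z s * Re (eta * phi (((rho k)%:C)%C * expi s))) =
      Re (eta * phi (((rho k)%:C)%C * z)).
    have [r0 rl] := r01 k; exact: (poisson_disk_series he (ltW r0) rl z1).
  have c1 : Re (eta * phi (((rho k)%:C)%C * z)) @[k --> \oo] --> Re (eta * phi z).
    suff /ccvgP [] // : cmod (eta * phi (((rho k)%:C)%C * z) - eta * phi z)
      @[k --> \oo] --> (0 : R) by [].
    apply: ccvgM; first exact: ccvg_cst.
    apply: disk_series_continuous hc z1 _.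
    have hr : cmod (((rho k)%:C)%C - 1) @[k --> \oo] --> (0 : R).
      have -> : (1 : C) = ((1 : R)%:C)%C by [].
      under eq_fun do rewrite -rmorphB cmod_real.
      rewrite -(normr0 R) -(subrr (1 : R)); apply: cvg_norm.
      by apply: cvgB => //; exact: cvg_cst.
    have : cmod (((rho k)%:C)%C * z - 1 * z) @[k --> \oo] --> (0 : R).
      exact: ccvgM hr (ccvg_cst z).
    by rewrite mul1r.
  have c2 : mean (fun s => poisson z s * Re (eta * phi (((rho k)%:C)%C * expi s)))
      @[k --> \oo] --> mean (fun s => poisson z s * Re (eta * g s)).
    have [bR _] := cbmM (cbm_cst eta) bg.
    apply: (@mean_bounded_cvg _ _ _ (B * cmod eta)).
    - move=> k; apply: measurable_funM => //; have [r0 rl] := r01 k.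
      by have [[]] := cbm_disk_series he (ltW r0) rl.
    - by apply: measurable_funM => //; case: bR.
    - move=> k s; have [r0 rl] := r01 k.
      rewrite normrM ler_pM//; apply: le_trans (Re_le_cmod _) _.
      by rewrite cmodM ler_piMr ?cmod_ge0// ltW// phi1// cmod_circle// ltW.
    - apply: ae_imp aeg => s hs /hs {}hs; apply: cvgMr.
      suff /ccvgP [] // : cmod (eta * phi (((rho k)%:C)%C * expi s) - eta * g s)
        @[k --> \oo] --> (0 : R) by [].
      exact: ccvgM (ccvg_cst eta) hs.
  rewrite (funext E) in c2; exact: (cvg_unique _ c2 c1).
split => //.
have [bR bI] := bg.
have := ae_and (poisson_radial_limit bR) (poisson_radial_limit bI).
apply: ae_imp => t [hR hI] ct; apply/ccvgP; split.
  apply: cvg_trans (hR ct); apply: near_eq_cvg; near=> r.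
  have z1 : cmod ((r%:C)%C * expi t) < 1.
    rewrite cmod_circle; first by near: r; exact: nbhs_left_lt.
    by near: r; exact: nbhs_left_ge.
  have := rep 1 _ z1; rewrite mul1r => <-.
  by apply: eq_mean => s; rewrite mul1r.
apply: cvg_trans (hI ct); apply: near_eq_cvg; near=> r.
have z1 : cmod ((r%:C)%C * expi t) < 1.
  rewrite cmod_circle; first by near: r; exact: nbhs_left_lt.
  by near: r; exact: nbhs_left_ge.
(* The multiplier -i reads off the imaginary part. *)
have ImE (x : C) : Re ((0 -i* 1)%C * x) = Im x.
  by rewrite Re_mul /= mul0r sub0r mulN1r opprK.
have := rep (0 -i* 1)%C _ z1; rewrite ImE => <-.
by apply: eq_mean => s; rewrite ImE.
Unshelve. all: by end_near. Qed.

End Fatou.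

(** * Construction of the weight from the boundary function *)

Section Sufficiency.
Variable R : realType.
Local Notation C := R[i].
Local Notation mu := (@lebesgue_measure R).
Implicit Types (w phi : C -> C).

Definition log_boundary (g : R -> C) (t : R) : R := - ln (1 - cmod (g t)).

(** A measurable function below the integrand of the statement inherits its finite integral, and
    finiteness almost everywhere then forces |g| < 1. *)
Lemma log_boundary_integrable phi (g : R -> C) : cbm g ->
  {ae mu, forall t, circle t -> radial_limit phi t (g t)} ->
  (circle_integral (log_integrand phi) < +oo)%E ->
  exists u : R -> R, circle_integrable u /\
    {ae mu, forall t, circle t -> cmod (g t) < 1 /\ u t = log_boundary g t}.
Proof.
move=> bg aeg fin.
have [mx _] := cbm_cmod bg.
have [N [mN N0 subN]] := aeg.
have mc := @measurable_circle R.
have mb : measurable_fun setT (fun t => cmod (g t) < 1).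
  by apply: measurable_fun_ltr.
have ml : measurable_fun setT (log_boundary g).
  apply: measurableT_comp => //; apply: measurableT_comp; first exact: measurable_ln.
  exact: measurable_funB.
(* Where |g t| >= 1 the real logarithm has only a default value, so +oo is imposed explicitly. *)
pose U t : \bar R := if cmod (g t) < 1 then (log_boundary g t)%:E else +oo%E.
have mU : measurable_fun setT U.
  by apply: measurable_fun_ifT => //; exact/measurable_EFinP.
have U0 t : (0 <= U t)%E.
  rewrite /U; case: ifP => // h; rewrite lee_fin oppr_ge0 ln_le0//.
  by rewrite gerBl cmod_ge0.
(* Setting the function to 0 on the exceptional null set makes the comparison hold at every point of
   the circle, as the monotonicity lemma demands. *)
pose V := U \_ (~` N).
have mV : measurable_fun setT V.
  apply/(measurable_restrictT _ _).1; first exact: measurableC.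
  exact: measurable_funTS.
have V0 t : (0 <= V t)%E by rewrite /V /patch; case: ifP.
have finL : (\int[mu]_(t in @circle R) log_integrand phi t < +oo)%E.
  move: fin; rewrite /circle_integral -/(@circle R); apply: contraTT.
  rewrite -!leNgt !leye_eq => /eqP ->.
  by rewrite gt0_muley// lte_fin invr_gt0 pi2_gt0.
have VL t : circle t -> (V t <= log_integrand phi t)%E.
  move=> ct; rewrite /V /patch; case: ifPn => h; last exact: log_integrand_ge0.
  have nN : ~ N t by move: h; rewrite inE.
  have rl : radial_limit phi t (g t).
    by apply: contrapT => nr; apply: nN; apply: subN => /= /(_ ct).
  rewrite /log_integrand (phistar_eq rl) /U; case: ifP => // h1.
  by rewrite lnV// posrE subr_gt0.
have iV : mu.-integrable (@circle R) V.
  apply/integrableP; split; first by apply: measurable_funTS; exact: mV.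
  apply: le_lt_trans finL; under eq_integral do rewrite gee0_abs//.
  by apply: ge0_le_integral_nonmeasurable.
have aeN : {ae mu, forall t, ~ N t}.
  by exists N; split => // t /= /contrapT.
exists (fun t => fine (V t)); split.
  apply: (@le_integrable _ _ _ mu (@circle R) mc _ V _ _ iV).
    apply/measurable_EFinP; apply: measurable_funTS.
    by apply: measurableT_comp => //; exact: measurable_fine.
  by move=> t _ /=; case: (V t) => [r| |] //=; rewrite leey.
have aeF := @integrable_ae _ _ _ mu (@circle R) mc _ iV.
apply: ae_imp (ae_and aeN aeF) => t [nN fV] ct; move: (fV ct).
by rewrite /V /patch mem_set// /U; case: ifP => // h _; split.
Qed.

(** This is ln y <= y - 1 at y = (1 - x) / (1 - p). *)
Lemma log_tangent (p x : R) : p < 1 -> x < 1 ->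
  - ln (1 - p) + (1 - p)^-1 * (x - p) <= - ln (1 - x).
Proof.
move=> p1 x1; have q0 : 0 < 1 - p by lra.
have y0 : 0 < 1 - x by lra.
have h : -1 < (1 - x) / (1 - p) - 1 by rewrite ltrBDl subrr divr_gt0.
have := le_ln1Dx h; rewrite addrC subrK lnM ?posrE ?invr_gt0// lnV ?posrE//.
have -> : (1 - p)^-1 * (x - p) = 1 - (1 - x) / (1 - p) by field; rewrite gt_eqF.
by lra.
Qed.

(* Jensen's inequality for [-ln (1 - x)] against the Poisson kernel, through its tangent
   line at [|phi z|]. *)
Lemma poisson_log_ge phi (g : R -> C) (u : R -> R) z : cbm g ->
  (forall z, cmod z < 1 -> cmod (phi z) < 1) ->
  (forall eta z : C, cmod z < 1 ->
      mean (fun s => poisson z s * Re (eta * g s)) = Re (eta * phi z)) ->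
  circle_integrable u ->
  {ae mu, forall t, circle t -> cmod (g t) < 1 /\ u t = log_boundary g t} ->
  cmod z < 1 -> - ln (1 - cmod (phi z)) <= mean (fun s => poisson z s * u s).
Proof.
move=> bg phi1 rep iu aeu z1; have bP := bm_poisson z1; have bx := cbm_cmod bg.
set p := cmod (phi z); have p1 : p < 1 by exact: phi1.
pose A := mean (fun s => poisson z s * cmod (g s)).
have pA : p <= A.
  (* Rotating phi z to its modulus turns the representation into |phi z| <= P[|g|] at z. *)
  have [eta [e1 ep]] : exists eta : C, cmod eta <= 1 /\ Re (eta * phi z) = p.
    have [z0|nz] := eqVneq (phi z) 0.
      by exists 0; rewrite mul0r cmod0 ler01 /p z0 cmod0.
    have p0 : p != 0 by rewrite cmod_eq0.
    exists (((phi z)^*)%C * ((p^-1)%:C)%C); split.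
      by rewrite cmodM cmod_conj cmod_real ger0_norm ?invr_ge0 ?cmod_ge0// divff.
    rewrite mulrAC [_ * phi z]mulrC mulc_conj -rmorphM /= -/p.
    by rewrite expr2 mulfK.
  rewrite -ep -rep//; apply: mean_le.
  - by apply: bm_integrable; apply: bmM => //; have [] := cbmM (cbm_cst eta) bg.
  - by apply: bm_integrable; exact: bmM.
  - move=> s _; rewrite ler_wpM2l ?poisson_ge0//.
    apply: le_trans (ler_norm _) _; apply: le_trans (Re_le_cmod _) _.
    by rewrite cmodM ler_piMl ?cmod_ge0.
pose k := - ln (1 - p) - (1 - p)^-1 * p.
(* The tangent line at p integrates to -ln (1 - p) + (A - p) / (1 - p), and A >= p. *)
apply: (@le_trans _ _ (mean (fun s => k * poisson z s +
    (1 - p)^-1 * (poisson z s * cmod (g s))))).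
  have i1 : circle_integrable (poisson z) by exact: bm_integrable.
  have i2 : circle_integrable (fun s => poisson z s * cmod (g s)).
    by apply: bm_integrable; exact: bmM.
  rewrite meanD; [|exact: ciZ|exact: ciZ].
  rewrite (meanZ k i1) (meanZ _ i2) mean_poisson// mulr1 -/A /k.
  have : 0 <= (1 - p)^-1 * (A - p) by rewrite mulr_ge0 ?invr_ge0; lra.
  by lra.
apply: mean_le_ae.
- by apply: bm_integrable; apply: bmD; apply: bmZ => //; exact: bmM.
- exact: ciM.
- apply: ae_imp aeu => s hs /hs [g1 ->].
  have -> : k * poisson z s + (1 - p)^-1 * (poisson z s * cmod (g s)) =
    poisson z s * (- ln (1 - p) + (1 - p)^-1 * (cmod (g s) - p)) by rewrite /k; ring.
  by rewrite ler_wpM2l ?poisson_ge0//; exact: log_tangent.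
Qed.

(** Pointwise, the sums of |w phi^k|^2 are at most (1 - |phi|) / (1 - |phi|^2) <= 1; Bessel's
    inequality at each radius transfers this to the coefficients, and the radius tends to 1 in
    finite sums. *)
Lemma double_bessel w phi (b : nat -> nat -> C) K L :
  (forall n, disk_series (wcomp w phi (fun z => z ^+ n)) (b n)) ->
  (forall z, cmod z < 1 -> cmod (phi z) < 1) ->
  (forall z, cmod z < 1 -> cmod (w z) ^+ 2 <= 1 - cmod (phi z)) ->
  \sum_(0 <= k < K) \sum_(0 <= l < L) cmod (b k l) ^+ 2 <= 1.
Proof.
move=> hb phi1 hw.
have low j : \sum_(0 <= k < K) \sum_(0 <= l < L)
    cmod (b k l) ^+ 2 * approach_radius R j ^+ l ^+ 2 <= 1.
  have r0 := approach_radius_gt0 R j; have r1 := approach_radius_lt1 R j.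
  set r := approach_radius R j in r0 r1 *.
  apply: (@le_trans _ _ (\sum_(0 <= k < K) mean (fun t =>
      cmod (wcomp w phi (fun z => z ^+ k) ((r%:C)%C * expi t)) ^+ 2))).
    by apply: ler_sum => k _; exact: bessel_disk (hb k) (ltW r0) r1.
  have ib k : bounded_measurable (fun t =>
      cmod (wcomp w phi (fun z => z ^+ k) ((r%:C)%C * expi t)) ^+ 2).
    by apply: cbm_sqr; exact: cbm_disk_series (hb k) (ltW r0) r1.
  rewrite -mean_sum; last by move=> k; exact: bm_integrable.
  rewrite -(@mean_cst R 1); apply: mean_le.
  - by apply: bm_integrable; exact: bm_sum.
  - exact/bm_integrable/bm_cst.
  - move=> t _; set z := (r%:C)%C * expi t.
    have z1 : cmod z < 1 by rewrite cmod_circle// ltW.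
    have x1 := phi1 _ z1; have x0 := cmod_ge0 (phi z).
    have d0 : 0 < 1 - cmod (phi z) by lra.
    have x20 : 0 <= cmod (phi z) ^+ 2 by rewrite exprn_ge0.
    have x21 : cmod (phi z) ^+ 2 < 1 by rewrite expr_lt1.
    apply: (@le_trans _ _ (\sum_(0 <= k < K) (1 - cmod (phi z)) * (cmod (phi z) ^+ 2) ^+ k)).
      apply: ler_sum => k _; rewrite /wcomp cmodM cmodX exprMn exprAC.
      by rewrite ler_wpM2r ?exprn_ge0 ?hw.
    rewrite -mulr_sumr; apply: le_trans (ler_wpM2l (ltW d0) (sum_geometric_le K x20 x21)) _.
    rewrite ler_pdivrMr ?subr_gt0// mul1r; nra.
have cv : \sum_(0 <= k < K) \sum_(0 <= l < L)
    cmod (b k l) ^+ 2 * approach_radius R j ^+ l ^+ 2 @[j --> \oo] -->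
    \sum_(0 <= k < K) \sum_(0 <= l < L) cmod (b k l) ^+ 2.
  have cvg_sum_nat (F : nat -> nat -> R) (l : nat -> R) m :
      (forall i, F i j @[j --> \oo] --> l i) ->
      \sum_(0 <= i < m) F i j @[j --> \oo] --> \sum_(0 <= i < m) l i.
    move=> hF; elim: m => [|m IH].
      by under eq_fun do rewrite big_geq//; rewrite big_geq//; exact: cvg_cst.
    by under eq_fun do rewrite big_nat_recr//=; rewrite big_nat_recr//=; exact: cvgD.
  apply: (cvg_sum_nat) => k; apply: cvg_sum_nat => l.
  rewrite -[X in _ --> X]mulr1; apply: cvgMr.
  under eq_fun do rewrite -exprM; rewrite -(expr1n _ (l * 2)).
  elim: (l * 2)%N => [|n IH]; first by under eq_fun do rewrite expr0; exact: cvg_cst.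
  under eq_fun do rewrite exprS; rewrite exprS; apply: cvgM => //.
  exact: cvg_approach_radius.
by apply: (cvgr_to_le cv); near=> j; exact: low.
Unshelve. all: by end_near. Qed.

Lemma cauchy_schwarz_nat (x y : nat -> R) K :
  (forall k, 0 <= x k) -> (forall k, 0 <= y k) ->
  (\sum_(0 <= k < K) x k * y k) ^+ 2 <=
  (\sum_(0 <= k < K) x k ^+ 2) * (\sum_(0 <= k < K) y k ^+ 2).
Proof.
move=> x0 y0; elim: K => [|K IH]; first by rewrite !big_geq// expr0n mul0r.
rewrite !big_nat_recr//=.
have X0 : 0 <= \sum_(0 <= k < K) x k ^+ 2 by apply: sumr_ge0 => k _; rewrite exprn_ge0.
have Y0 : 0 <= \sum_(0 <= k < K) y k ^+ 2 by apply: sumr_ge0 => k _; rewrite exprn_ge0.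
have S0 : 0 <= \sum_(0 <= k < K) x k * y k by apply: sumr_ge0 => k _; rewrite mulr_ge0.
move: (\sum_(0 <= k < K) x k ^+ 2) (\sum_(0 <= k < K) y k ^+ 2)
  (\sum_(0 <= k < K) x k * y k) X0 Y0 S0 IH => X Y S X0 Y0 S0 IH.
move: (x K) (y K) (x0 K) (y0 K) => p q p0 q0.
(* Comparing squares: S^2 <= X Y by induction, and 4 X Y p^2 q^2 <= (X q^2 + Y p^2)^2. *)
have h : 2 * S * (p * q) <= X * q ^+ 2 + Y * p ^+ 2.
  rewrite -ler_sqr ?nnegrE ?addr_ge0 ?mulr_ge0 ?exprn_ge0//.
  apply: (@le_trans _ _ (4 * (X * Y) * (p * q) ^+ 2)).
    have -> : (2 * S * (p * q)) ^+ 2 = 4 * S ^+ 2 * (p * q) ^+ 2 by ring.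
    by rewrite ler_wpM2r ?exprn_ge0 ?mulr_ge0// ler_wpM2l.
  rewrite -subr_ge0.
  have -> : (X * q ^+ 2 + Y * p ^+ 2) ^+ 2 - 4 * (X * Y) * (p * q) ^+ 2 =
    (X * q ^+ 2 - Y * p ^+ 2) ^+ 2 by ring.
  exact: sqr_ge0.
have -> : (S + p * q) ^+ 2 = S ^+ 2 + 2 * S * (p * q) + (p * q) ^+ 2 by ring.
have -> : (X + p ^+ 2) * (Y + q ^+ 2) = X * Y + (X * q ^+ 2 + Y * p ^+ 2) + (p * q) ^+ 2 by ring.
by rewrite lerD2r lerD.
Qed.

(** The n-th coefficient of w (f o phi) is the sum over k of c_k b_(k,n); Cauchy-Schwarz in k bounds
    the operator norm by the Hilbert-Schmidt norm. *)
Lemma double_bessel_bounded w phi (b : nat -> nat -> C) :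
  (forall z, cmod z < 1 -> cmod (phi z) < 1) ->
  (forall n, disk_series (wcomp w phi (fun z => z ^+ n)) (b n)) ->
  (forall K L, \sum_(0 <= k < K) \sum_(0 <= l < L) cmod (b k l) ^+ 2 <= 1) ->
  wcomp_bounded w phi.
Proof.
move=> phi1 hb b1; exists 1 => f c hf cfin; rewrite mul1e.
pose H := fine (H2norm2 c).
have HE : H2norm2 c = H%:E by rewrite fineK// ge0_fin_numE// H2norm2_ge0.
have cH K : \sum_(0 <= k < K) cmod (c k) ^+ 2 <= H.
  by rewrite -lee_fin -HE psum_le_H2norm2.
have H0 : 0 <= H by apply: le_trans (cH 0%N); rewrite big_geq.
have [||e [he ce]] := @disk_series_series _ (fun k => wcomp w phi (fun z => z ^+ k))
  b c (wcomp w phi f) hb.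
(* From |c| |b| s^n <= s^n |c|^2 + |b|^2: the first part sums to at most H / (1 - s), the second to
   at most 1. *)
- move=> s s0 s1; exists (H * (1 - s)^-1 + 1) => K N.
  apply: (@le_trans _ _ (\sum_(0 <= k < K) (cmod (c k) ^+ 2 * \sum_(0 <= n < N) s ^+ n +
      \sum_(0 <= n < N) cmod (b k n) ^+ 2))).
    apply: ler_sum => k _; rewrite !mulr_sumr -big_split /=; apply: ler_sum => n _.
    have sn0 : 0 <= s ^+ n by rewrite exprn_ge0.
    have sn1 : s ^+ n <= 1 by rewrite exprn_ile1// ltW.
    have x0 := cmod_ge0 (c k); have y0 := cmod_ge0 (b k n).
    move: (cmod (c k)) (cmod (b k n)) (s ^+ n) sn0 sn1 x0 y0 => x y q q0 q1 x0 y0.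
    have h1 : x * y <= x ^+ 2 + y ^+ 2 by have := sqr_ge0 (x - y); nra.
    have h2 : q * (x * y) <= q * (x ^+ 2 + y ^+ 2) by rewrite ler_wpM2l.
    have h3 : q * y ^+ 2 <= y ^+ 2 by rewrite ler_piMl// exprn_ge0.
    have -> : x * (y * q) = q * (x * y) by ring.
    by apply: le_trans h2 _; rewrite mulrDr mulrC lerD.
  rewrite big_split /= -mulr_suml lerD//.
  by rewrite ler_pM// ?sumr_ge0 ?sum_geometric_le// => k _; rewrite exprn_ge0 ?cmod_ge0.
- move=> z z1; have h := hf (phi z) (phi1 z z1).
  apply: cvg_trans (ccvgM (ccvg_cst (w z)) h); apply: near_eq_cvg; near=> K.
  congr (cmod (_ - _)); rewrite mulr_sumr; apply: eq_bigr => k _.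
  by rewrite /wcomp mulrCA.
exists e; split => //; rewrite HE.
apply: lime_le.
  by apply: is_cvg_nneseries => n _ _; rewrite lee_fin exprn_ge0// cmod_ge0.
have cv N : \sum_(0 <= n < N) cmod (\sum_(0 <= k < K) c k * b k n) ^+ 2 @[K --> \oo] -->
    \sum_(0 <= n < N) cmod (e n) ^+ 2.
  elim: N => [|N IH].
    by under eq_fun do rewrite big_geq//; rewrite big_geq//; exact: cvg_cst.
  under eq_fun do rewrite big_nat_recr//=; rewrite big_nat_recr//=; apply: cvgD => //.
  by under eq_fun do rewrite expr2; rewrite expr2; apply: cvgM; exact: cvg_cmod.
near=> N; rewrite sumEFin lee_fin; apply: (cvgr_to_le (cv N)); near=> K.
apply: (@le_trans _ _ (\sum_(0 <= n < N) H * \sum_(0 <= k < K) cmod (b k n) ^+ 2)).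
  apply: ler_sum => n _.
  apply: (@le_trans _ _ ((\sum_(0 <= k < K) cmod (c k) * cmod (b k n)) ^+ 2)).
    rewrite ler_pXn2r ?nnegrE ?cmod_ge0//; last first.
      by apply: sumr_ge0 => k _; rewrite mulr_ge0 ?cmod_ge0.
    apply: le_trans (cmod_le_sum _ _ _) _.
    by apply: ler_sum => k _; rewrite cmodM.
  apply: le_trans (cauchy_schwarz_nat _ _ _) _ => [k|k|]; rewrite ?cmod_ge0//.
  by rewrite ler_wpM2r// sumr_ge0// => k _; rewrite exprn_ge0 ?cmod_ge0.
rewrite -mulr_sumr exchange_big /=.
by rewrite -[leRHS]mulr1 ler_wpM2l.
Unshelve. all: by end_near. Qed.

Theorem log_integrable_HS phi : analytic_selfmap phi ->
  (circle_integral (log_integrand phi) < +oo)%E ->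
  exists w, inH2 w /\ (exists z, cmod z < 1 /\ w z != 0) /\ wcomp_HS w phi.
Proof.
move=> hphi fin; have [[c hc] phi1] := hphi.
have [g [bg aeg rep]] := fatou_radial hphi.
have [u [iu aeu]] := log_boundary_integrable bg aeg fin.
(* The sign makes |W|^2 the exponential of the Poisson integral of ln (1 - |g|). *)
have [W [e [hW WP _]]] := outer_function (ciN iu).
have WE z : cmod z < 1 -> cmod (W z) ^+ 2 <= 1 - cmod (phi z).
  move=> z1; rewrite WP//; under eq_fun do rewrite mulrN.
  rewrite meanN; last by apply: ciM => //; exact: bm_poisson.
  have d0 : 0 < 1 - cmod (phi z) by rewrite subr_gt0 phi1.
  rewrite -[leRHS]lnK ?posrE// ler_expR lerNl.
  exact: poisson_log_ge bg phi1 rep iu aeu z1.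
pose b n := cauchy_prod e (cauchy_pow c n).
have hb n : disk_series (wcomp W phi (fun z => z ^+ n)) (b n).
  by apply: disk_seriesM => //; exact: disk_seriesX.
have b1 K L := double_bessel K L hb phi1 WE.
have norm_le K : (\sum_(0 <= k < K) H2norm2 (b k) <= 1)%E.
  have t0 k l : (0 <= (cmod (b k l) ^+ 2)%:E)%E by rewrite lee_fin exprn_ge0// cmod_ge0.
  rewrite /H2norm2 -nneseries_sum_nat//.
  apply: lime_le; first by apply: is_cvg_nneseries => n _ _; exact: sume_ge0.
  near=> L; under eq_bigr do rewrite sumEFin.
  by rewrite sumEFin lee_fin exchange_big.
exists W; split; last split.
(* Since phi^0 = 1, the entry n = 0 of the Hilbert-Schmidt sum is the squared norm of [W] itself. *)
- exists (b 0%N); split.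
    by have := hb 0%N; rewrite /wcomp; under eq_fun do rewrite expr0 mulr1.
  by have := norm_le 1%N; rewrite big_nat1 => /le_lt_trans; apply; rewrite ltry.
- have o1 : cmod (0 : C) < 1 by rewrite cmod0.
  exists 0; split => //; rewrite -cmod_eq0 -sqrf_eq0 WP//.
  by rewrite gt_eqF// expR_gt0.
- split; first exact: double_bessel_bounded phi1 hb b1.
  exists b; split => //; apply: (@le_lt_trans _ _ 1%E); last by rewrite ltry.
  apply: lime_le; first by apply: is_cvg_nneseries => n _ _; exact: H2norm2_ge0.
  by near=> K; exact: norm_le.
Unshelve. all: by end_near. Qed.

End Sufficiency.

Theorem theorem4p1 (R : realType) (phi : R[i] -> R[i]) :
  analytic_selfmap phi ->
  ((exists w : R[i] -> R[i],
      inH2 w /\ (exists z, cmod z < 1 /\ w z != 0) /\ wcomp_HS w phi) <->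
   (circle_integral (log_integrand phi) < +oo)%E).
Proof.
move=> hphi; split; last exact: log_integrable_HS.
by move=> [w [w2 [w0 hs]]]; exact: HS_log_integrable w2 w0 hs.
Qed.
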